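(* Let $C=12$. There exists $k_0$ such that for all integers $k\ge k_0$ and all integers $n > Ck$, every intersecting family $\mathcal{F} \subset \binom{[n]}{k}$ satisfies $$d_{k+2}(\mathcal{F}) \le \binom{n-2}{k-2}.$$
   Context: $[n]=\{1,\dots,n\}$ and $\binom{[n]}{k}$ is the family of all $k$-element subsets of $[n]$. A family $\mathcal{F}$ of sets is intersecting if $|A\cap B|\ge 1$ for all $A,B\in\mathcal{F}$. The degree of $i\in[n]$ in $\mathcal{F}$ is the number of sets $A\in\mathcal{F}$ with $i\in A$. The $n$ degrees of the elements of $[n]$ (counted with multiplicity) are arranged in non-increasing order $d_1(\mathcal{F})\ge d_2(\mathcal{F})\ge\cdots\ge d_n(\mathcal{F})$, so $d_r(\mathcal{F})$ is the $r$-th largest degree. *)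

(* Defs.v *)
From mathcomp Require Import all_boot.

Set Implicit Arguments.
Unset Strict Implicit.
Unset Printing Implicit Defensive.

(* The ground set [n] is represented by 'I_n = {0, ..., n - 1}. *)

Definition ksets (n k : nat) : {set {set 'I_n}} := [set A : {set 'I_n} | #|A| == k].

(* A and B may coincide, so the members of an intersecting family are nonempty. *)
Definition intersecting (n : nat) (F : {set {set 'I_n}}) : Prop :=
  forall A B : {set 'I_n}, A \in F -> B \in F -> 1 <= #|A :&: B|.

Definition degree (n : nat) (F : {set {set 'I_n}}) (i : 'I_n) : nat :=
  #|[set A in F | i \in A]|.

Definition degree_seq (n : nat) (F : {set {set 'I_n}}) : seq nat :=
  sort geq [seq degree F i | i : 'I_n].

(* The r-th largest degree, meant for 1 <= r <= n: r counts from 1, nth from 0. *)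
Definition dlargest (n : nat) (F : {set {set 'I_n}}) (r : nat) : nat :=
  nth 0 (degree_seq F) r.-1.

(* Main.v *)
Require Import Defs.
From mathcomp Require Import all_boot all_order all_algebra.
From mathcomp Require Import ring lra zify.

(** Let the degrees of [k + 2] elements, forming a set [S], all exceed
    ['C(n - 2, k - 2)]; the point is to reach a contradiction. Uniform families
    are replaced by their up-closures, measured by the product measure of bias
    [p], slightly more than [k / (n - 2)] ([prob_up_closure]); [p] is at most a
    little above [1 / 12]. Two tools are available for that measure.

    The first one replaces the Kruskal-Katona theorem. The intersection of [m]
    random sets of bias [q] is a random set of bias [q ^+ m], and all of them
    lie in an up-set as soon as their intersection does; so the measure of an
    up-set at bias [q ^+ m] is at most the [m]-th power of its measure at bias
    [q] ([prob_upset_exp]). Since a random set and its complement are disjoint,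
    a family that cross-intersects a family of measure bounded away from 0 has
    measure at most about a power of [p] ([cross_int_small]).

    The second one is a stability result. Two cross-intersecting families span no
    disjoint pair, which is an identity between their Fourier coefficients. If
    both measures are at least nearly [p], it puts a large part of the weight on
    the coefficients of singletons; by a fourth moment inequality a family of
    small measure cannot have this property unless some element has a large
    influence ([cross_int_influential]).

    The proof combines them as follows. A variance computation provides two
    elements [i] and [j] of [S] such that a proportion at most about [p] of
    the members through either of them contain both ([exists_sparse_pair]). The
    members through [i] but not [j] and those through [j] but not [i] are
    cross-intersecting with measures at least about [p], so some [z] is influential, and
    few members avoid both [z] and, say, [i]. Bootstrapping with the first tool,
    for each [l] in [S] other than [z] very few members avoid both [z] and [l]
    ([exists_centre]).

    Let [G] be the family of the members avoiding [z], and let [l] be in [S]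
    and different from [z]. The sets [A :\: [set z; l]], for members [A]
    through [z] and [l], are among the [k - 2]-sets that meet all members of [G]
    avoiding [l]. As the degree of [l] exceeds the number ['C(n - 2, k - 2)] of
    all [k - 2]-sets on the other elements, the number of members of [G] through
    [l] exceeds the number of [k - 2]-sets disjoint from a member of [G] avoiding
    [l]; by the first tool the latter is much larger than the number of members
    of [G] avoiding [l] ([small_family_avoiders]). Hence most members of [G]
    contain most of [S], which makes [G] exponentially small; the same
    comparison then improves so much that some member of [G] has to contain
    every element of [S] other than [z]. There are at least [k + 1] of these
    ([no_rich_set]). *)

Set Implicit Arguments.
Unset Strict Implicit.
Unset Printing Implicit Defensive.

Import Order.TTheory GRing.Theory Num.Theory.

(** * Weighted Cauchy-Schwarz inequality *)

Section CauchySchwarz.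
Local Open Scope ring_scope.
Variables (R : realFieldType) (I : finType).
Implicit Types (P : pred I) (w f g : I -> R).

(** Lagrange's identity: twice the difference of the two sides is the double sum
    of the weighted squares of [f i * g j - f j * g i]. *)
Lemma weighted_cauchy_schwarz P w f g : (forall i, P i -> 0 <= w i) ->
  (\sum_(i | P i) w i * (f i * g i)) ^+ 2 <=
  (\sum_(i | P i) w i * f i ^+ 2) * (\sum_(i | P i) w i * g i ^+ 2).
Proof.
move=> w0.
suff : 0 <= \sum_(i | P i) \sum_(j | P j)
         w i * w j * (f i * g j - f j * g i) ^+ 2.
  have -> : \sum_(i | P i) \sum_(j | P j) w i * w j * (f i * g j - f j * g i) ^+ 2
    = \sum_(i | P i) \sum_(j | P j) (w i * f i ^+ 2) * (w j * g j ^+ 2)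
      + \sum_(i | P i) \sum_(j | P j) (w i * g i ^+ 2) * (w j * f j ^+ 2)
      - 2 * \sum_(i | P i) \sum_(j | P j) (w i * (f i * g i)) * (w j * (f j * g j)).
    rewrite mulr_sumr -sumrN -!big_split /=; apply: eq_bigr => i _.
    rewrite mulr_sumr -sumrN -!big_split /=; apply: eq_bigr => j _.
    by ring.
  by rewrite -!big_distrlr /=; lra.
apply: sumr_ge0 => i Pi; apply: sumr_ge0 => j Pj.
by rewrite mulr_ge0 ?sqr_ge0 ?mulr_ge0 ?w0.
Qed.

End CauchySchwarz.

(** * Biased product measure on the subsets of a finite type *)

Section ProductMeasure.
Local Open Scope ring_scope.
Variables (R : realFieldType) (T : finType).
Implicit Types (p q : R) (X Y Z D : {set T}) (f g : {set T} -> R) (z : T).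

Definition weight p X : R := \prod_z (if z \in X then p else 1 - p).

Definition expect p f : R := \sum_X weight p X * f X.

Definition prob p (E : pred {set T}) : R := expect p (fun X => (E X)%:R).

Lemma eq_expect p f g : f =1 g -> expect p f = expect p g.
Proof. by move=> fg; apply: eq_bigr => X _; rewrite fg. Qed.

(** Expanding the product over the elements into a sum over subsets gives back
    the product weights. *)
Lemma expect_prod p (h : T -> bool -> R) :
  expect p (fun X => \prod_z h z (z \in X)) =
  \prod_z (p * h z true + (1 - p) * h z false).
Proof.
rewrite /expect bigA_distr; apply: eq_bigr => X _.
by rewrite -big_split; apply: eq_bigr => z _ /=; case: (z \in X).
Qed.

Lemma expectD p f g : expect p (fun X => f X + g X) = expect p f + expect p g.
Proof. by rewrite -big_split; apply: eq_bigr => X _; rewrite mulrDr. Qed.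

Lemma expectZ p c f : expect p (fun X => c * f X) = c * expect p f.
Proof. by rewrite /expect mulr_sumr; apply: eq_bigr => X _; rewrite mulrCA. Qed.

Lemma expect_sum p (I : finType) (P : pred I) (F : I -> {set T} -> R) :
  expect p (fun X => \sum_(i | P i) F i X) = \sum_(i | P i) expect p (F i).
Proof.
rewrite /expect exchange_big; apply: eq_bigr => X _.
by rewrite mulr_sumr.
Qed.

Lemma expect_cst p c : expect p (fun=> c) = c.
Proof.
rewrite (@eq_expect _ _ (fun X => c * \prod_(z : T) 1)); last first.
  by move=> X; rewrite big1_eq mulr1.
rewrite expectZ (expect_prod p (fun _ _ => 1)) big1 ?mulr1 // => z _.
by ring.
Qed.

Lemma weight_ge0 p X : 0 <= p <= 1 -> 0 <= weight p X.
Proof.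
by move=> /andP[p0 p1]; apply: prodr_ge0 => z _; case: ifP; rewrite ?subr_ge0.
Qed.

Lemma le_expect p f g : 0 <= p <= 1 -> (forall X, f X <= g X) ->
  expect p f <= expect p g.
Proof.
by move=> p01 fg; apply: ler_sum => X _; rewrite ler_wpM2l ?weight_ge0.
Qed.

Lemma le_prob p (E E' : pred {set T}) : 0 <= p <= 1 ->
  (forall X, E X -> E' X) -> prob p E <= prob p E'.
Proof.
move=> p01 EE'; apply: le_expect => // X.
by case: (E X) (EE' X) => [-> //|_]; rewrite ler0n.
Qed.

Lemma prob_ge0 p (E : pred {set T}) : 0 <= p <= 1 -> 0 <= prob p E.
Proof.
by move=> p01; rewrite -(expect_cst p 0); apply: le_expect.
Qed.

Lemma prob_le1 p (E : pred {set T}) : 0 <= p <= 1 -> prob p E <= 1.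
Proof.
move=> p01; rewrite -(expect_cst p 1); apply: le_expect => // X.
by case: (E X); rewrite ?ler01.
Qed.

Lemma probC p (E : pred {set T}) : prob p (fun X => ~~ E X) = 1 - prob p E.
Proof.
apply/eqP; rewrite eq_sym subr_eq -(expect_cst p 1) -expectD; apply/eqP.
by apply: eq_expect => X; case: (E X); rewrite ?addr0 ?add0r.
Qed.

Lemma expect_setC p f : expect (1 - p) f = expect p (fun X => f (~: X)).
Proof.
rewrite /expect (reindex_inj (@setC_inj T)); apply: eq_bigr => X _ /=.
congr (_ * _); apply: eq_bigr => z _; rewrite in_setC.
by case: (z \in X) => //=; rewrite subKr.
Qed.

(** Conditioning on the presence of one element; the independence of the elements
    is used in this form. *)
Lemma expect_cond p z f :
  expect p f = expect p (fun X => p * f (z |: X) + (1 - p) * f (X :\ z)).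
Proof.
have split_z g : expect p g = \sum_(X : {set T} | z \notin X)
    (\prod_(y | y != z) (if y \in X then p else 1 - p))
      * (p * g (z |: X) + (1 - p) * g X).
  rewrite /expect (bigID (fun X : {set T} => z \notin X)) /=.
  rewrite [X in _ + X](reindex_onto (fun X => z |: X) (fun X => X :\ z)) /=; last first.
    by move=> X; rewrite negbK => zX; rewrite setD1K.
  rewrite [X in _ + X](_ : _ = \sum_(X : {set T} | z \notin X)
      weight p (z |: X) * g (z |: X)); last first.
    apply: eq_bigl => X; rewrite negbK setU11 /=.
    by apply/eqP/idP => [<-|zX]; [rewrite setD11 | rewrite setU1K].
  rewrite -big_split; apply: eq_bigr => X zX /=.
  rewrite /weight (bigD1 z) //= (negbTE zX) [X in _ + X * _](bigD1 z) //= setU11.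
  rewrite (eq_bigr (fun y => if y \in X then p else 1 - p)); last first.
    by move=> y yz.
  rewrite [\prod_(i | _) (if i \in z |: X then _ else _)]
    (eq_bigr (fun y => if y \in X then p else 1 - p)); last first.
    by move=> y yz; rewrite in_setU1 (negbTE yz).
  by ring.
rewrite !split_z; apply: eq_bigr => X zX; congr (_ * _).
have -> : z |: (z |: X) = z |: X by rewrite setUA setUid.
rewrite setU1K //.
have -> : X :\ z = X.
  apply/setP=> y; rewrite in_setD1; case: eqP => //= ->.
  by rewrite (negbTE zX).
by ring.
Qed.

Lemma expect_indep p z f (h : bool -> R) :
  (forall X, f (z |: X) = f (X :\ z)) ->
  expect p (fun X => f X * h (z \in X)) =
  expect p f * (p * h true + (1 - p) * h false).
Proof.
move=> fz; rewrite (expect_cond p z) [in RHS](expect_cond p z).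
rewrite mulrC -expectZ; apply: eq_expect => X.
by rewrite setU11 setD11 fz; ring.
Qed.

Lemma expect_cauchy_schwarz p f g : 0 <= p <= 1 ->
  expect p (fun X => f X * g X) ^+ 2 <=
  expect p (fun X => f X ^+ 2) * expect p (fun X => g X ^+ 2).
Proof. by move=> p01; apply: weighted_cauchy_schwarz => X _; apply: weight_ge0. Qed.

(** The intersection of two independent samples of biases [p] and [q] is a sample
    of bias [p * q]; all comparisons between different biases come from this. *)
Lemma expect_setI p q f :
  expect p (fun X => expect q (fun Y => f (X :&: Y))) = expect (p * q) f.
Proof.
have pick Z X Y : (X :&: Y == Z)%:R =
    \prod_z (((z \in X) && (z \in Y)) == (z \in Z))%:R :> R.
  rewrite -natr_prod; congr (_%:R).
  case: (pickP (fun z => ((z \in X) && (z \in Y)) != (z \in Z))) => [z XYz|XYZ].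
    rewrite (bigD1 z) //= (negbTE XYz) mul0n.
    by case: (X :&: Y =P Z) XYz => // <-; rewrite in_setI eqxx.
  have -> : X :&: Y = Z.
    by apply/setP=> z; rewrite in_setI; apply/eqP/negbFE/XYZ.
  by rewrite eqxx big1 // => z _; rewrite (negbFE (XYZ z)).
have fE X Y : f (X :&: Y) = \sum_Z f Z * (X :&: Y == Z)%:R.
  rewrite (bigD1 (X :&: Y)) //= eqxx mulr1 big1 ?addr0 // => Z neq.
  by rewrite eq_sym (negbTE neq) mulr0.
transitivity (\sum_Z f Z * expect p (fun X => expect q (fun Y => (X :&: Y == Z)%:R))).
  rewrite -(eq_bigr _ (fun Z _ => expectZ _ _ _)) -expect_sum.
  apply: eq_expect => X.
  rewrite -(eq_bigr _ (fun Z _ => expectZ _ _ _)) -expect_sum.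
  by apply: eq_expect => Y; apply: fE.
apply: eq_bigr => Z _; rewrite mulrC; congr (_ * _).
rewrite (@eq_expect _ _ (fun X => \prod_z (q * ((z \in X) == (z \in Z))%:R
    + (1 - q) * (false == (z \in Z))%:R))); last first.
  move=> X; rewrite (@eq_expect _ _ (fun Y => \prod_z
     (((z \in X) && (z \in Y)) == (z \in Z))%:R)); last by move=> Y; apply: pick.
  rewrite (expect_prod q (fun z b => (((z \in X) && b) == (z \in Z))%:R)).
  by apply: eq_bigr => z _; rewrite andbT andbF.
rewrite (expect_prod p (fun z b => q * (b == (z \in Z))%:R
    + (1 - q) * (false == (z \in Z))%:R)).
by apply: eq_bigr => z _; case: (z \in Z) => /=; ring.
Qed.

End ProductMeasure.

(** * Up-sets and cross-intersecting families *)

Section Upsets.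
Local Open Scope ring_scope.
Variables (R : archiRealFieldType) (T : finType).
Implicit Types (p q c : R) (X Y W : {set T}) (E : pred {set T}).

Definition upset E := forall X Y, X \subset Y -> E X -> E Y.

Definition cross_int E E' := forall X Y, E X -> E' Y -> X :&: Y != set0.

Lemma prob_upsetM p q E : upset E -> 0 <= p <= 1 -> 0 <= q <= 1 ->
  prob (p * q) E <= prob p E * prob q E.
Proof.
move=> upE p01 q01; rewrite /prob -expect_setI mulrC -expectZ.
apply: le_expect => // X; rewrite mulrC -expectZ; apply: le_expect => // Y.
case EXY: (E (X :&: Y)); last by rewrite mulr_ge0.
by rewrite (upE _ _ (subsetIl X Y)) // (upE _ _ (subsetIr X Y)) // mulr1.
Qed.

(** If the intersection of [m] independent samples of bias [q] lies in an up-set,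
    then so does each of the samples. For [p = q ^+ m] this is the
    Kruskal-Katona inequality in product form, [log_p (prob p E)] being
    monotone in [p]; a smaller [p] only decreases the left-hand side. *)
Lemma prob_upset_exp p q m E : upset E -> 0 <= p -> 0 < q <= 1 ->
  p <= q ^+ m -> prob p E <= prob q E ^+ m.
Proof.
move=> upE p0 /andP[q0 q1] pqm.
have q01 : 0 <= q <= 1 by rewrite ltW.
have qm01 j : 0 <= q ^+ j <= 1 by have q0' := ltW q0; rewrite exprn_ge0 ?exprn_ile1.
have ht : 0 <= p / q ^+ m <= 1.
  by rewrite divr_ge0 ?exprn_ge0 ?(ltW q0) //= ler_pdivrMr ?exprn_gt0 // mul1r.
rewrite -{1}[p](divfK (lt0r_neq0 (exprn_gt0 m q0))) [_ / _ * _]mulrC.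
elim: m {pqm} (p / q ^+ m) ht => [|m IHm] t ht.
  by rewrite !expr0 mul1r; apply: prob_le1.
rewrite !exprS -mulrA; apply: le_trans (prob_upsetM upE q01 _) _.
  have /andP[a0 a1] := qm01 m; have /andP[t0 t1] := ht.
  by rewrite mulr_ge0 // mulr_ile1.
by rewrite ler_wpM2l ?prob_ge0 // IHm.
Qed.

(** A random set and its complement are disjoint, so they cannot lie in [E] and
    [E'] respectively. *)
Lemma cross_int_prob p E E' : cross_int E E' -> 0 <= p <= 1 ->
  prob p E + prob (1 - p) E' <= 1.
Proof.
move=> EE' p01; rewrite /prob expect_setC -expectD -[leRHS](expect_cst T p 1).
apply: le_expect => // X.
rewrite /= -natrD lern1.
case EX: (E X); case E'X: (E' (~: X)) => //.
by have := EE' _ _ EX E'X; rewrite setICr eqxx.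
Qed.

Lemma exists_bracketing_power p : 0 < p < 1 ->
  exists m, (1 - p) ^+ m.+1 < p <= (1 - p) ^+ m.
Proof.
move=> /andP[p0 p1].
have ex : exists m, (1 - p) ^+ m < p.
  have h0 : 0 <= (p ^+ 2)^-1 by rewrite invr_ge0 exprn_ge0 ?ltW.
  exists (Num.Def.archi_bound (p ^+ 2)^-1).
  set m := Num.Def.archi_bound _.
  have hm : (p ^+ 2)^-1 < m%:R by apply: archi_boundP.
  have bern j : (1 - p) ^+ j * (1 + p *+ j) <= 1.
    elim: j => [|j IHj]; first by rewrite expr0 mulr0n addr0 mulr1.
    apply: le_trans IHj; rewrite exprS [(1 - p) * _]mulrC -mulrA.
    rewrite ler_wpM2l ?exprn_ge0 ?subr_ge0 ?ltW // mulrS.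
    have : 0 <= p *+ j by rewrite mulrn_wge0 ?ltW.
    by nra.
  have hpm : p^-1 < p *+ m.
    rewrite -mulr_natr -ltr_pdivrMl //.
    by move: hm; rewrite expr2 invfM.
  have q0 : 0 < (1 - p) ^+ m by rewrite exprn_gt0 ?subr_gt0.
  have : (1 - p) ^+ m * p^-1 < 1.
    apply: lt_le_trans (bern m); rewrite ltr_pM2l //; lra.
  by rewrite ltr_pdivrMr // mul1r.
case: (ex_minnP ex) => -[|m] hm min; first by move: hm; rewrite expr0; lra.
exists m; rewrite hm leNgt /=; apply/negP => /min.
by rewrite ltnn.
Qed.

(** If [E] is dense, then [E'] has measure at most [c] at bias [1 - p]. Going down
    from [1 - p] to [p], which is about [(1 - p) ^+ m], raises this to the power
    [m], and [c <= (1 - p) ^+ s] turns [c ^+ m] into about [p ^+ s]. The division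
    by [c] pays for rounding [m] down. *)
Lemma cross_int_small p c s E E' : cross_int E E' -> upset E' ->
  0 < p < 1 -> 0 < c -> c <= (1 - p) ^+ s -> 1 - c <= prob p E ->
  prob p E' <= p ^+ s / c.
Proof.
move=> EE' upE' /[dup] hp /andP[p0 p1] c0 cs Ec.
have p01 : 0 <= p <= 1 by rewrite !ltW.
have q01 : 0 <= 1 - p <= 1 by lra.
have [m /andP[pm1 pm]] := exists_bracketing_power hp.
have E'c : prob (1 - p) E' <= c by have := cross_int_prob EE' p01; lra.
apply: (@le_trans _ _ (c ^+ m)).
  apply: (@le_trans _ _ (prob (1 - p) E' ^+ m)).
    by apply: prob_upset_exp => //; [apply: ltW|lra].
  by rewrite lerXn2r ?nnegrE ?prob_ge0 // ltW.
rewrite ler_pdivlMr // -exprSr.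
apply: (@le_trans _ _ (((1 - p) ^+ s) ^+ m.+1)).
  by rewrite lerXn2r ?nnegrE ?exprn_ge0 // ?ltW //; lra.
rewrite exprAC lerXn2r ?nnegrE ?exprn_ge0 ?ltW //; lra.
Qed.

End Upsets.

(** * From uniform families to their up-closures *)

Section Layers.
Local Open Scope ring_scope.
Variables (R : realFieldType) (T : finType).
Implicit Types (p : R) (X Y A W : {set T}) (U : {set {set T}}) (phi : nat -> R).

(** Mean of [phi] over a binomial variable with [n] trials of success probability
    [p]. The recursion on [n] follows the conditioning on one element at a
    time, and shows that the mean depends on the underlying set only through
    its cardinal. *)
Fixpoint binomial_mean p n phi : R :=
  if n is n'.+1 then
    p * binomial_mean p n' (phi \o succn) + (1 - p) * binomial_mean p n' phi
  else phi 0%N.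

Lemma eq_binomial_mean p n phi psi : phi =1 psi ->
  binomial_mean p n phi = binomial_mean p n psi.
Proof.
elim: n phi psi => [|n IHn] phi psi eq_phi /=; first exact: eq_phi.
by congr (_ * _ + _ * _); apply: IHn => m /=.
Qed.

Lemma binomial_mean_exp p n t :
  binomial_mean p n (fun m => t ^+ m) = (p * t + (1 - p)) ^+ n.
Proof.
have scale m c phi :
    binomial_mean p m (fun j => c * phi j) = c * binomial_mean p m phi.
  elim: m phi => [|m IHm] phi //=; rewrite IHm.
  rewrite (@eq_binomial_mean _ _ _ (fun j => c * (phi \o succn) j)) // IHm.
  by ring.
elim: n => [|n IHn] //=.
rewrite (@eq_binomial_mean _ _ _ (fun m => t * t ^+ m)); last first.
  by move=> m /=; rewrite exprS.
by rewrite scale IHn exprS; ring.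
Qed.

Lemma expect_card p W phi :
  expect p (fun X => phi #|X :&: W|) = binomial_mean p #|W| phi.
Proof.
move: {2}#|W| (erefl #|W|) => n.
elim: n W phi => [|n IHn] W phi cardW.
  rewrite cardW (@eq_expect _ _ _ _ (fun=> phi 0%N)) ?expect_cst // => X.
  by rewrite (cards0_eq cardW) setI0 cards0.
have /set0Pn[z zW] : W != set0 by rewrite -card_gt0 cardW.
have cardWz : #|W :\ z| = n by have := cardsD1 z W; rewrite zW cardW => -[].
rewrite (expect_cond p z) expectD !expectZ cardW /= -cardWz -!IHn //.
congr (_ * _ + _ * _); apply: eq_expect => X /=.
  rewrite setIUl (setIidPl _) ?sub1set // (_ : _ :|: _ = z |: X :&: (W :\ z)).
    by rewrite cardsU1 !inE eqxx andbF.
  apply/setP=> y; rewrite !inE; case: (y == z) => //=.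
rewrite (_ : (X :\ z) :&: W = X :&: (W :\ z)) //.
by apply/setP=> y; rewrite !inE; case: (y == z); rewrite ?andbF.
Qed.

Lemma expect_superset p A W phi : A \subset W ->
  expect p (fun X => (A \subset X)%:R * phi #|X :&: W|) =
  p ^+ #|A| * binomial_mean p (#|W| - #|A|) (fun m => phi (#|A| + m)%N).
Proof.
move: {2}#|A| (erefl #|A|) => n.
elim: n A W phi => [|n IHn] A W phi cardA AW.
  rewrite cardA expr0 mul1r subn0 -expect_card; apply: eq_expect => X.
  by rewrite (cards0_eq cardA) sub0set mul1r.
have /set0Pn[z zA] : A != set0 by rewrite -card_gt0 cardA.
have zW := subsetP AW _ zA.
have cardAz : #|A :\ z| = n by have := cardsD1 z A; rewrite zA cardA => -[].
have := cardsD1 z W; rewrite zW add1n => cardWz.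
rewrite (expect_cond p z) (@eq_expect _ _ _ _ (fun X =>
   p * ((A :\ z \subset X)%:R * (phi \o succn) #|X :&: (W :\ z)|))); last first.
  move=> X; rewrite subsetD1 zA andbF mul0r mulr0 addr0 -subDset setDE.
  rewrite [_ :&: ~: _ \subset X](_ : _ = (A :\ z \subset X)); last first.
    by rewrite setDE.
  rewrite /=; congr (_ * (_ * phi _)).
  rewrite (_ : _ :&: W = z |: X :&: (W :\ z)).
    by rewrite cardsU1 !inE eqxx andbF.
  by apply/setP=> y; rewrite !inE; case: eqP => [->|] //=.
rewrite expectZ IHn ?setSD // cardA cardAz cardWz subSS exprS mulrA.
by congr (_ * _); apply: eq_binomial_mean => m /=; rewrite addSn.
Qed.

Definition up_closure U : pred {set T} := fun X => [exists A in U, A \subset X].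

Lemma up_closure_upset U : upset (up_closure U).
Proof.
move=> X Y XY /existsP[A /andP[UA AX]]; apply/existsP; exists A.
by rewrite UA (subset_trans AX).
Qed.

(** Local LYM inequality, averaged over the layers of [W]. Give each [l]-subset of
    [X :&: W] the weight [1 / 'C(#|X :&: W|, l)]: the members of [U] below [X]
    have total weight at most 1, and 0 outside the up-closure. The expected
    weight [e] is the same for all [l]-subsets of [W], and all of them together
    weigh 1 whenever [X :&: W] has at least [l] elements. *)
Lemma prob_up_closure p W l U : 0 <= p <= 1 ->
  (forall A, A \in U -> A \subset W /\ #|A| = l) ->
  #|U|%:R * prob p (fun X => (l <= #|X :&: W|)%N) <=
  prob p (up_closure U) * 'C(#|W|, l)%:R.
Proof.
move=> p01 UW.
have [->|/set0Pn[A0 UA0]] := eqVneq U set0.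
  by rewrite cards0 mul0r mulr_ge0 ?prob_ge0.
have [A0W A0l] := UW _ UA0.
pose phi j : R := (l <= j)%N%:R / 'C(j, l)%:R.
(* The choice of [A0] does not matter. *)
pose e : R := expect p (fun X => (A0 \subset X)%:R * phi #|X :&: W|).
have eE A : A \subset W -> #|A| = l ->
    expect p (fun X => (A \subset X)%:R * phi #|X :&: W|) = e.
  by move=> AW Al; rewrite /e !expect_superset // Al A0l.
have subE (V : {set {set T}}) X : \sum_(A in V) (A \subset X)%:R * phi #|X :&: W| =
    #|[set A in V | A \subset X]|%:R * phi #|X :&: W|.
  rewrite -mulr_suml -natr_sum; congr (_%:R * _).
  by rewrite -sum1dep_card [RHS]big_mkcondr; apply: eq_bigr => A _; case: ifP.
have eW : 'C(#|W|, l)%:R * e = prob p (fun X => (l <= #|X :&: W|)%N).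
  pose V := [set A : {set T} | A \subset W & #|A| == l].
  rewrite -(cards_draws W l) mulr_natl -sumr_const.
  rewrite (eq_bigr (fun A => expect p (fun X => (A \subset X)%:R * phi #|X :&: W|))); last first.
    by move=> A; rewrite inE => /andP[AW /eqP Al]; rewrite eE.
  rewrite -expect_sum; apply: eq_expect => X; rewrite subE.
  rewrite [[set A in _ | _]](_ : _ = [set A : {set T} | A \subset X :&: W & #|A| == l]).
    rewrite cards_draws /phi; case: leqP => [lX|]; last by rewrite mul0r mulr0.
    by rewrite mul1r divff // pnatr_eq0 -lt0n bin_gt0.
  by apply/setP=> A; rewrite !inE subsetI andbC andbA.
have eU : #|U|%:R * e <= prob p (up_closure U).
  rewrite mulr_natl -sumr_const.
  rewrite (eq_bigr (fun A => expect p (fun X => (A \subset X)%:R * phi #|X :&: W|))); last first.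
    by move=> A /UW[AW Al]; rewrite eE.
  rewrite -expect_sum; apply: le_expect => // X; rewrite subE /phi.
  case: leqP => [lX|]; last by rewrite mul0r mulr0 ler0n.
  have C0 : (0 < 'C(#|X :&: W|, l)%:R :> R) by rewrite ltr0n bin_gt0.
  rewrite mul1r ler_pdivrMr //.
  case UX: (up_closure U X).
    rewrite mul1r ler_nat -cards_draws subset_leq_card //.
    apply/subsetP=> A; rewrite !inE => /andP[/UW[AW ->] AX].
    by rewrite eqxx andbT subsetI AX.
  rewrite mul0r (_ : [set A in U | _] = set0) ?cards0 //.
  apply/setP=> A; rewrite !inE; apply/negbTE; move/negbT: UX.
  by apply: contra => UAX; apply/existsP; exists A.
rewrite -eW mulrCA mulrC ler_wpM2r ?ler0n //.
Qed.

End Layers.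

(** * Fourier analysis of cross-intersecting families *)

Section Fourier.
Local Open Scope ring_scope.
Variables (R : realFieldType) (T : finType).
Implicit Types (p : R) (X Y D : {set T}) (f g : {set T} -> R) (z : T).

(** The characters are left unnormalised: dividing by their standard deviation
    would introduce the square root of [p * (1 - p)]. *)
Definition centred p z X : R := (z \in X)%:R - p.

Definition fcoef p f D := expect p (fun X => f X * \prod_(z in D) centred p z X).

Definition influence p f z := expect p (fun X => f (z |: X) - f (X :\ z)).

Lemma fcoef0 p f : fcoef p f set0 = expect p f.
Proof. by apply: eq_expect => X; rewrite big_set0 mulr1. Qed.

Lemma fcoef1 p f z : fcoef p f [set z] = p * (1 - p) * influence p f z.
Proof.
rewrite /fcoef (expect_cond p z) -expectZ; apply: eq_expect => X.
by rewrite !big_set1 /centred setU11 setD11 /=; ring.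
Qed.

Lemma sum_card1 (F : {set T} -> R) : \sum_(D : {set T} | #|D| == 1%N) F D = \sum_z F [set z].
Proof.
rewrite -(big_imset _ (in2W set1_inj)) /=; apply: eq_bigl => D.
apply/cards1P/imsetP => [[z ->]|[z _ ->]]; by exists z.
Qed.

(** Product kernels are diagonal in the basis of products of [centred] functions:
    expand the product over [z] into a sum over subsets. *)
Lemma kernel_expansion p f g rho :
  expect p (fun X => f X * expect p (fun Y =>
    g Y * \prod_z (1 + rho * (centred p z X * centred p z Y)))) =
  \sum_(D : {set T}) rho ^+ #|D| * (fcoef p f D * fcoef p g D).
Proof.
transitivity (\sum_(D : {set T}) expect p (fun X => fcoef p g D * rho ^+ #|D| *
    (f X * \prod_(z in D) centred p z X))); last first.
  by apply: eq_bigr => D _; rewrite expectZ /fcoef; ring.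
rewrite -expect_sum; apply: eq_expect => X.
transitivity (f X * \sum_(D : {set T}) expect p (fun Y => rho ^+ #|D| *
    \prod_(z in D) centred p z X * (g Y * \prod_(z in D) centred p z Y))); last first.
  by rewrite mulr_sumr; apply: eq_bigr => D _; rewrite expectZ /fcoef; ring.
congr (_ * _); rewrite -expect_sum; apply: eq_expect => Y.
under eq_bigr do rewrite addrC.
rewrite bigA_distr mulr_sumr; apply: eq_big => // D _.
rewrite -big_mkcond /= !big_split /= prodr_const; ring.
Qed.

Lemma weight_gt0 p X : 0 < p < 1 -> 0 < weight p X.
Proof.
by move=> /andP[p0 p1]; apply: prodr_gt0 => z _; case: ifP; rewrite ?subr_gt0.
Qed.

(** For [rho = (p * (1 - p))^-1] the kernel of [kernel_expansion] is the identity: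
    its factor vanishes as soon as [X] and [Y] differ at [z]. *)
Lemma parseval p f : 0 < p < 1 ->
  \sum_(D : {set T}) (p * (1 - p))^-1 ^+ #|D| * fcoef p f D ^+ 2 = expect p (fun X => f X ^+ 2).
Proof.
move=> p01; have /andP[p0 p1] := p01.
have q0 : 1 - p != 0 by rewrite subr_eq0 gt_eqF.
have p0' := lt0r_neq0 p0.
transitivity (\sum_(D : {set T}) (p * (1 - p))^-1 ^+ #|D| * (fcoef p f D * fcoef p f D)).
  by apply: eq_bigr => D _; rewrite expr2.
rewrite -kernel_expansion; apply: eq_expect => X; rewrite expr2; congr (_ * _).
have kernel Y : \prod_z (1 + (p * (1 - p))^-1 * (centred p z X * centred p z Y)) =
    if X == Y then (weight p X)^-1 else 0.
  case: eqP => [<-|XY].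
    rewrite -prodfV; apply: eq_bigr => z _; rewrite /centred.
    by case: (z \in X) => /=; field; rewrite p0' q0.
  case: (pickP (fun z => (z \in X) != (z \in Y))) => [z XYz|XYz].
    rewrite (bigD1 z) //= [X in X * _](_ : _ = 0) ?mul0r // /centred.
    by case: (z \in X) XYz; case: (z \in Y) => //= _; field; rewrite p0' q0.
  by case: XY; apply/setP=> z; apply/eqP/negbFE/XYz.
rewrite /expect (bigD1 X) //= kernel eqxx big1 ?addr0 => [|Y YX].
  by rewrite mulrCA divff ?mulr1 // gt_eqF ?weight_gt0.
by rewrite kernel eq_sym (negbTE YX) !mulr0.
Qed.

(** For this value of [rho] the factor of the kernel at [z] vanishes when [z] lies
    in both sets, so the kernel only charges disjoint pairs, of which there are
    none in [E] times [E']. It is the Hoffman bound for the Kneser graph, with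
    the eigenvalues [(- p / (1 - p)) ^+ j]. *)
Lemma cross_int_fourier p (E E' : pred {set T}) : cross_int E E' -> 0 < p < 1 ->
  \sum_(D : {set T}) (- ((1 - p) ^+ 2)^-1) ^+ #|D| *
     (fcoef p (fun X => (E X)%:R) D * fcoef p (fun X => (E' X)%:R) D) = 0.
Proof.
move=> EE' /andP[p0 p1]; rewrite -kernel_expansion -[RHS](expect_cst T p 0).
have q0 : 1 - p != 0 by rewrite subr_eq0 gt_eqF.
apply: eq_expect => X; case EX: (E X); last by rewrite mul0r.
rewrite mul1r -[RHS](expect_cst T p 0); apply: eq_expect => Y.
case EY: (E' Y); last by rewrite mul0r.
have /set0Pn[z] := EE' _ _ EX EY; rewrite inE => /andP[zX zY].
rewrite mul1r (bigD1 z) //= [X in X * _](_ : _ = 0) ?mul0r // /centred zX zY /=.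
by field.
Qed.

End Fourier.

(** * Moments of a centred linear form *)

Section FourthMoment.
Local Open Scope ring_scope.
Variables (R : realFieldType) (T : finType) (p : R) (u : T -> R).
Hypothesis p01 : 0 <= p <= 1.
Implicit Types (s : seq T) (z : T) (X : {set T}).

Definition linear_form s (X : {set T}) : R := \sum_(z <- s) u z * centred p z X.

Let L1 s : expect p (linear_form s) = 0.
Proof.
rewrite /linear_form /expect; under eq_bigr do rewrite mulr_sumr.
rewrite exchange_big big1_seq // => z _.
transitivity (expect p (fun X => u z * (1 * centred p z X))).
  by apply: eq_bigr => X _; rewrite mul1r.
by rewrite expectZ (expect_indep p (fun b => b%:R - p)) // expect_cst /=; ring.
Qed.

Let indep z s k j : z \notin s ->
  expect p (fun X => linear_form s X ^+ k * centred p z X ^+ j) =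
  expect p (fun X => linear_form s X ^+ k) * (p * (1 - p) ^+ j + (1 - p) * (- p) ^+ j).
Proof.
move=> zs; rewrite (expect_indep p (fun b => (b%:R - p) ^+ j)) ?sub0r // => X.
congr (_ ^+ k); apply: eq_big_seq => y ys; rewrite /centred !inE.
by have /negbTE-> : y != z by apply: contraNneq zs => <-.
Qed.

Let moment z j : expect p (fun X => centred p z X ^+ j) =
  p * (1 - p) ^+ j + (1 - p) * (- p) ^+ j.
Proof.
transitivity (expect p (fun X => 1 * centred p z X ^+ j)).
  by apply: eq_expect => X; rewrite mul1r.
by rewrite (expect_indep p (fun b => (b%:R - p) ^+ j)) // expect_cst mul1r sub0r.
Qed.

Lemma second_moment s : uniq s ->
  expect p (fun X => linear_form s X ^+ 2) = p * (1 - p) * \sum_(z <- s) u z ^+ 2.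
Proof.
elim: s => [_|z s IHs /= /andP[zs us]].
  rewrite big_nil mulr0 -[RHS](expect_cst T p); apply: eq_expect => X.
  by rewrite /linear_form big_nil expr0n.
transitivity (expect p (fun X => linear_form s X ^+ 2 + (
   2 * u z * (linear_form s X ^+ 1 * centred p z X ^+ 1)
   + u z ^+ 2 * centred p z X ^+ 2))).
  by apply: eq_expect => X; rewrite /linear_form big_cons; ring.
rewrite expectD IHs // expectD !expectZ !indep // moment big_cons.
rewrite [expect p (fun X => linear_form s X ^+ 1)]L1.
by ring.
Qed.

(** By induction on the support: when an independent term is added to the form,
    the cross terms of odd degree have mean 0, both summands being centred. *)
Lemma fourth_moment s : uniq s ->
  expect p (fun X => linear_form s X ^+ 4) <=
  3 * (p * (1 - p) * \sum_(z <- s) u z ^+ 2) ^+ 2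
  + p * (1 - p) * \sum_(z <- s) u z ^+ 4.
Proof.
elim: s => [_|z s IHs /= /andP[zs us]].
  rewrite !big_nil !mulr0 expr0n mulr0 addr0 -[leRHS](expect_cst T p).
  by apply: le_expect => // X; rewrite /linear_form big_nil expr0n.
rewrite (@eq_expect _ _ _ _ (fun X => linear_form s X ^+ 4 + (
   4 * u z * (linear_form s X ^+ 3 * centred p z X ^+ 1)
   + (6 * u z ^+ 2 * (linear_form s X ^+ 2 * centred p z X ^+ 2)
   + (4 * u z ^+ 3 * (linear_form s X ^+ 1 * centred p z X ^+ 3)
   + u z ^+ 4 * centred p z X ^+ 4))))); last first.
  by move=> X; rewrite /linear_form big_cons; ring.
rewrite expectD; apply: le_trans (lerD (IHs us) (lexx _)) _.
rewrite !expectD !expectZ !indep // moment second_moment // !big_cons.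
rewrite [expect p (fun X => linear_form s X ^+ 1)]L1.
have /andP[p0 p1] := p01.
set S2 := \sum_(y <- s) _; set S4 := \sum_(y <- s) _.
rewrite -subr_ge0 [X in 0 <= X](_ : _ = 6 * (p * (1 - p)) ^+ 2 * u z ^+ 4).
  apply: mulr_ge0; last exact: exprn_even_ge0.
  by apply: mulr_ge0; [apply: ler0n | apply: sqr_ge0].
by ring.
Qed.

End FourthMoment.

(** * Level-one weight and influential elements *)

Section Influential.
Local Open Scope ring_scope.
Variables (R : realFieldType) (T : finType).
Implicit Types (p : R) (E : pred {set T}).

Lemma influence_ge0 p E z : upset E -> 0 <= p <= 1 ->
  0 <= influence p (fun X => (E X)%:R) z.
Proof.
move=> upE p01; rewrite -(expect_cst T p 0); apply: le_expect => // X.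
rewrite subr_ge0 ler_nat.
case EX: (E (X :\ z)) => //; rewrite (upE _ _ _ EX) //.
exact: subset_trans (subD1set X z) (subsetUr _ _).
Qed.

(** Squared norm of the part of the indicator of [E] spanned by the [centred]
    functions, computed from [fcoef1]. *)
Definition level1_weight p E : R :=
  p * (1 - p) * \sum_z influence p (fun X => (E X)%:R) z ^+ 2.

(** The level-one weight is the correlation of the indicator of [E] with a linear
    form. Two applications of Cauchy-Schwarz bound its fourth power by the
    cube of the measure times the fourth moment of that form, so a small set
    can have a large level-one weight only if some influence is large. *)
Lemma level1_weight_small_set p E : 0 <= p <= 1 ->
  level1_weight p E ^+ 4 <= prob p E ^+ 3 * (3 * level1_weight p E ^+ 2
    + p * (1 - p) * \sum_z influence p (fun X => (E X)%:R) z ^+ 4).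
Proof.
move=> p01; set W := level1_weight p E; set f := fun X => (E X)%:R : R.
pose L := linear_form p (influence p f) (index_enum T).
have f2 X : f X ^+ 2 = f X by rewrite /f; case: (E X); rewrite ?expr1n ?expr0n.
have EfL : expect p (fun X => f X * L X) = W.
  transitivity (\sum_z expect p (fun X => influence p f z *
     (f X * \prod_(y in [set z]) centred p y X))).
    rewrite -expect_sum; apply: eq_expect => X; rewrite mulr_sumr.
    by apply: eq_bigr => z _; rewrite big_set1; ring.
  rewrite /W /level1_weight mulr_sumr; apply: eq_bigr => z _.
  by rewrite expectZ -/(fcoef p f [set z]) fcoef1; ring.
have ge0 (g : {set T} -> R) : (forall X, 0 <= g X) -> 0 <= expect p g.
  by move=> g0; rewrite -(expect_cst T p 0); apply: le_expect.
have f0 X : 0 <= f X by apply: ler0n.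
have h1 : W ^+ 2 <= prob p E * expect p (fun X => f X * L X ^+ 2).
  have := expect_cauchy_schwarz f (fun X => f X * L X) p01.
  rewrite (@eq_expect _ _ _ _ (fun X => f X * L X)) ?EfL; last first.
    by move=> X; rewrite mulrA -expr2 f2.
  rewrite (@eq_expect _ _ _ (fun X => f X ^+ 2) f) //.
  rewrite (@eq_expect _ _ _ (fun X => (f X * L X) ^+ 2) (fun X => f X * L X ^+ 2)) //.
  by move=> X; rewrite exprMn f2.
have h2 : expect p (fun X => f X * L X ^+ 2) ^+ 2 <=
    prob p E * expect p (fun X => L X ^+ 4).
  have := expect_cauchy_schwarz f (fun X => L X ^+ 2) p01.
  rewrite (@eq_expect _ _ _ (fun X => f X ^+ 2) f) //.
  rewrite (@eq_expect _ _ _ (fun X => (L X ^+ 2) ^+ 2) (fun X => L X ^+ 4)) //.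
  by move=> X; rewrite -exprM.
have h3 := fourth_moment (influence p f) p01 (index_enum_uniq T).
have a0 := prob_ge0 E p01.
apply: (@le_trans _ _ ((prob p E * expect p (fun X => f X * L X ^+ 2)) ^+ 2)).
  rewrite -[4%N]/(2 * 2)%N exprM lerXn2r ?nnegrE ?sqr_ge0 //.
  by rewrite mulr_ge0 ?ge0 // => X; rewrite mulr_ge0 ?sqr_ge0.
rewrite exprMn [X in _ <= X * _]exprSr -[leRHS]mulrA ler_wpM2l ?sqr_ge0 //.
by apply: le_trans h2 _; rewrite ler_wpM2l.
Qed.

(** Split the Fourier sum of [cross_int_fourier] according to the size of the
    index: the empty set gives the product of the measures, singletons give
    [r * X1], and the remaining terms carry a factor at most [r ^+ 2]; [X1] and
    [Y] are then bounded by Cauchy-Schwarz and Parseval. *)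
Lemma cross_int_level1 p E E' : cross_int E E' -> 0 < p <= 2^-1 ->
  let r := p / (1 - p) in
  exists X1 Y, [/\ prob p E * prob p E' <= r * X1 + r ^+ 2 * Y, 0 <= Y,
    Y ^+ 2 <= prob p E * prob p E', 
    X1 ^+ 2 <= level1_weight p E * level1_weight p E' &
    level1_weight p E' <= prob p E'].
Proof.
move=> EE' /andP[p0 p12] r; have p1 : p < 1 by lra.
have p01 : 0 < p < 1 by rewrite p0.
have q0 : 0 < 1 - p by rewrite subr_gt0.
set s := p * (1 - p).
have s0 : 0 < s by rewrite mulr_gt0.
pose f (F : pred {set T}) := fun X => (F X)%:R : R.
pose v F := influence p (f F).
have f2 (F : pred {set T}) : expect p (fun X => f F X ^+ 2) = prob p F.
  by apply: eq_expect => X; rewrite /f; case: (F X); rewrite ?expr1n ?expr0n.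
have w0 (D : {set T}) : 0 <= s^-1 ^+ #|D| by rewrite exprn_ge0 // invr_ge0 ltW.
have sub F (P : pred {set T}) :
    \sum_(D | P D) s^-1 ^+ #|D| * fcoef p (f F) D ^+ 2 <= prob p F.
  rewrite -f2 -parseval // [leRHS](bigID P) /= lerDl.
  by apply: sumr_ge0 => D _; rewrite mulr_ge0 ?sqr_ge0.
pose Y := \sum_(D : {set T} | (1 < #|D|)%N)
   s^-1 ^+ #|D| * (`|fcoef p (f E) D| * `|fcoef p (f E') D|).
exists (s * \sum_z v E z * v E' z), Y; split.
- have := cross_int_fourier EE' p01.
  rewrite (bigD1 set0) //= (bigID (fun D : {set T} => #|D| == 1%N)) /=.
  rewrite (eq_bigl (fun D : {set T} => #|D| == 1%N)); last first.
    by move=> D; rewrite -cards_eq0; case: #|D| => [|[]].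
  rewrite sum_card1 (eq_bigl (fun D : {set T} => (1 < #|D|)%N)); last first.
    by move=> D; rewrite -cards_eq0; case: #|D| => [|[]].
  rewrite cards0 expr0 mul1r !fcoef0 -/(prob p E) -/(prob p E').
  rewrite (eq_bigr (fun z => - (r * s) * (v E z * v E' z))); last first.
    move=> z _; rewrite cards1 !fcoef1 /v /f /r /s.
    by field; rewrite gt_eqF.
  rewrite -mulr_sumr; set Q := \sum_(D : {set T} | _) _ => h.
  suff : - Q <= r ^+ 2 * Y by lra.
  rewrite /Y mulr_sumr -sumrN; apply: ler_sum => D D1.
  apply: le_trans (ler_norm _) _; rewrite normrN !normrM [leRHS]mulrA.
  rewrite ler_wpM2r ?mulr_ge0 ?normr_ge0 //.
  rewrite normrX normrN ger0_norm ?invr_ge0 ?sqr_ge0 //.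
  rewrite (_ : ((1 - p) ^+ 2)^-1 = r * s^-1); last first.
    by rewrite /r /s; field; rewrite !gt_eqF.
  rewrite exprMn ler_wpM2r //.
  apply: ler_wiXn2l; rewrite /r ?divr_ge0 ?(ltW p0) ?(ltW q0) // ler_pdivrMr //; lra.
- by apply: sumr_ge0 => D _; rewrite mulr_ge0 ?mulr_ge0 ?normr_ge0.
- apply: le_trans (weighted_cauchy_schwarz _ _ _) _ => //.
  rewrite ler_pM ?sumr_ge0 // => [D _|D _||]; rewrite ?mulr_ge0 ?sqr_ge0 //.
    by under eq_bigr do rewrite real_normK ?num_real //; apply: sub.
  by under eq_bigr do rewrite real_normK ?num_real //; apply: sub.
- rewrite exprMn /level1_weight -/s [leRHS](_ : _ = s ^+ 2 *
     ((\sum_z v E z ^+ 2) * \sum_z v E' z ^+ 2)); last by rewrite /v /f; ring.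
  rewrite ler_wpM2l ?sqr_ge0 //.
  have := @weighted_cauchy_schwarz _ _ predT (fun=> 1) (v E) (v E') (fun _ _ => ler01).
  have mul1 (g : T -> R) : \sum_z 1 * g z = \sum_z g z.
    by apply: eq_bigr => z _; rewrite mul1r.
  by rewrite !mul1.
- apply: le_trans (sub E' (fun D => #|D| == 1%N)).
  rewrite sum_card1 /level1_weight -/s mulr_sumr; apply: ler_sum => z _.
  rewrite cards1 fcoef1 -/s expr1 le_eqVlt; apply/orP; left; apply/eqP.
  by rewrite /f; field; rewrite gt_eqF.
Qed.

End Influential.

Section Influential.
Local Open Scope ring_scope.
Variables (R : realFieldType) (T : finType).
Implicit Types (p : R) (E : pred {set T}).

(** The second bound limits the measure of the smaller family, the third one says
    that level one has to carry most of the product of the measures. The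
    bound [21 / 250] on [p] is the one that [n > 12 * k] provides. *)
Lemma ratio_bounds p : 0 < p <= 21 / 250 -> let r := p / (1 - p) in
  [/\ 0 < r, r + r ^+ 2 <= 1002 / 10000 & 4 / 5 * r <= 49 / 50 * p - r ^+ 2].
Proof.
move=> /andP[p0 p1] r.
have q0 : 0 < 1 - p by lra.
have rE : r * (1 - p) = p by rewrite divfK ?gt_eqF.
have r0 : 0 < r by rewrite divr_gt0.
have r1 : r <= 21 / 229 by rewrite ler_pdivrMr //; lra.
have r2 : r ^+ 2 <= (21 / 229) ^+ 2 by rewrite lerXn2r ?nnegrE //; lra.
split=> //; first by lra.
have q1 : 0 < 1 + r by lra.
have pr : p * (1 + r) = r by rewrite mulrDr mulr1 -[X in X + _]rE; ring.
rewrite -(ler_pM2r q1) [leRHS](_ : _ = 49 / 50 * (p * (1 + r)) - r ^+ 2 * (1 + r)); last by ring.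
rewrite pr.
have : 0 <= r * (9 / 50 - 9 / 5 * r - r ^+ 2) by rewrite mulr_ge0 ?(ltW r0) //; lra.
by lra.
Qed.

(** [X1] and [Y] are at most the square root of [P], itself at least [t]; so
    [r ^+ 2 * Y] is at most [r ^+ 2 * P / t] and the rest of [P] comes from [X1]. *)
Lemma level1_arith (r t P X1 Y : R) : 0 < r -> 0 < t -> 4 / 5 * r <= t - r ^+ 2 ->
  t ^+ 2 <= P -> P <= r * X1 + r ^+ 2 * Y -> 0 <= Y -> Y ^+ 2 <= P -> X1 ^+ 2 <= P ->
  16 / 25 * P <= X1 ^+ 2 /\ P <= (r + r ^+ 2) ^+ 2.
Proof.
move=> r0 t0 rt tP hXY Y0 Y2 X2.
have P0 : 0 < P by apply: lt_le_trans tP; rewrite exprn_gt0.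
have [r0' t0' P0'] : [/\ 0 <= r, 0 <= t & 0 <= P] by rewrite !ltW.
have Yt : Y * t <= P.
  rewrite -(@ler_pXn2r _ 2) ?nnegrE ?mulr_ge0 //.
  by rewrite exprMn expr2; apply: ler_pM; rewrite ?sqr_ge0.
have X1t : 4 / 5 * P <= X1 * t.
  have h : P * t <= r * (X1 * t) + r ^+ 2 * P.
    apply: (@le_trans _ _ ((r * X1 + r ^+ 2 * Y) * t)); first by rewrite ler_wpM2r.
    have -> : (r * X1 + r ^+ 2 * Y) * t = r * (X1 * t) + r ^+ 2 * (Y * t) by ring.
    by rewrite lerD2l ler_wpM2l ?sqr_ge0.
  have h' : (4 / 5 * r) * P <= (t - r ^+ 2) * P by rewrite ler_wpM2r.
  rewrite -(ler_pM2l r0); clear -h h'; lra.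
have X0 : 0 < X1.
  by rewrite -(pmulr_lgt0 _ t0); apply: lt_le_trans X1t; rewrite mulr_gt0 //; lra.
have X0' := ltW X0.
split.
  have h1 : (4 / 5 * P) ^+ 2 <= (X1 * t) ^+ 2.
    by rewrite lerXn2r ?nnegrE ?mulr_ge0 //; lra.
  have h2 : X1 ^+ 2 * t ^+ 2 <= X1 ^+ 2 * P by rewrite ler_wpM2l ?sqr_ge0.
  rewrite -(ler_pM2r P0); clear -h1 h2; lra.
have max_bound M : 0 <= M -> M ^+ 2 <= P -> X1 <= M -> Y <= M ->
    P <= (r + r ^+ 2) ^+ 2.
  move=> M0 M2 XM YM.
  have PM : P <= (r + r ^+ 2) * M.
    by apply: le_trans hXY _; rewrite mulrDl lerD // ler_wpM2l ?sqr_ge0.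
  have rM : 0 <= (r + r ^+ 2) * M by rewrite mulr_ge0 // addr_ge0 ?sqr_ge0.
  rewrite -(ler_pM2r P0) -expr2; apply: (@le_trans _ _ (((r + r ^+ 2) * M) ^+ 2)).
    by rewrite lerXn2r ?nnegrE.
  by rewrite exprMn ler_wpM2l ?sqr_ge0.
have [XY|/ltW YX] := lerP X1 Y; first exact: (max_bound Y).
exact: (max_bound X1).
Qed.

Lemma level1_lower (p a b X1 Y : R) : 0 < p <= 21 / 250 -> 49 / 50 * p <= a -> a <= b ->
  let r := p / (1 - p) in
  a * b <= r * X1 + r ^+ 2 * Y -> 0 <= Y -> Y ^+ 2 <= a * b -> X1 ^+ 2 <= a * b ->
  16 / 25 * (a * b) <= X1 ^+ 2 /\ a <= 1002 / 10000.
Proof.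
move=> hp pa ab r hXY Y0 Y2 X2; have /andP[p0 _] := hp.
have [r0 r1 r2] := ratio_bounds hp; rewrite -/r in r0 r1 r2.
have t0 : 0 < 49 / 50 * p by clear -p0; lra.
have a0 : 0 < a by apply: lt_le_trans pa.
have aP : a ^+ 2 <= a * b by rewrite expr2 ler_pM2l.
have tP : (49 / 50 * p) ^+ 2 <= a * b.
  by apply: le_trans aP; rewrite lerXn2r ?nnegrE // ltW.
have [WX hP] := level1_arith r0 t0 r2 tP hXY Y0 Y2 X2.
split=> //; apply: le_trans r1.
rewrite -(@ler_pXn2r _ 2) ?nnegrE ?addr_ge0 ?sqr_ge0 ?(ltW r0) ?(ltW a0) //.
exact: le_trans aP hP.
Qed.

(** Weak stability for cross-intersecting families of nearly extremal measure:
    the Fourier identity puts a proportion at least [16 / 25] of the weight of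
    the smaller family onto level one, which [level1_weight_small_set] forbids
    when all influences are below [1 / 4]. *)
Lemma cross_int_influential p E E' : cross_int E E' -> upset E ->
  0 < p <= 21 / 250 -> 49 / 50 * p <= prob p E -> prob p E <= prob p E' ->
  exists z, 1 / 4 <= influence p (fun X => (E X)%:R) z.
Proof.
move=> EE' upE hp pa ab.
have [p0 p1] := andP hp.
have a0 : 0 < prob p E by clear -p0 pa; lra.
have b0 := lt_le_trans a0 ab.
have p12 : 0 < p <= 2^-1 by lra.
have p01 : 0 <= p <= 1 by lra.
have s0 : 0 <= p * (1 - p) by rewrite mulr_ge0; lra.
have [X1 [Y [h1 Y0 Y2 X2 Wb]]] := cross_int_level1 EE' p12.
have Wa : level1_weight p E <= prob p E.
  have E'E : cross_int E' E by move=> X Z E'X EZ; rewrite setIC; apply: EE'.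
  by have [? [? []]] := cross_int_level1 E'E p12.
set a := prob p E in pa ab a0 h1 Y2 X2 Wb Wa *.
set b := prob p E' in ab b0 h1 Y2 X2 Wb.
have W0 F : 0 <= level1_weight p F.
  rewrite mulr_ge0 //.
  by apply: sumr_ge0 => z _; apply: sqr_ge0.
have [WX a1] : 16 / 25 * (a * b) <= X1 ^+ 2 /\ a <= 1002 / 10000.
  apply: level1_lower hp pa ab h1 Y0 Y2 _.
  by apply: le_trans X2 _; rewrite ler_pM.
set W := level1_weight p E in W0 Wa X2.
have W64 : 16 / 25 * a <= W.
  rewrite -(ler_pM2r b0) [leLHS](_ : _ = 16 / 25 * (a * b)); last by ring.
  apply: (le_trans WX); apply: (le_trans X2).
  by rewrite ler_wpM2l ?W0.
case: (pickP (fun z => 1 / 4 <= influence p (fun X => (E X)%:R) z)) => [z hz|small].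
  by exists z.
have S4 : p * (1 - p) * \sum_z influence p (fun X => (E X)%:R) z ^+ 4 <= W / 16.
  rewrite /W /level1_weight -[leRHS]mulrA ler_wpM2l //.
  rewrite mulr_suml; apply: ler_sum => z _.
  have := small z; move/negbT; rewrite -ltNge.
  have := influence_ge0 z upE p01; set u := influence _ _ _ => u0 u4.
  have u2 : u ^+ 2 <= 16^-1 by clear -u0 u4; nra.
  rewrite -[4%N]/(2 + 2)%N exprD ler_wpM2l ?sqr_ge0 //.
have := level1_weight_small_set E p01; rewrite -/W -/a => h4.
have {h4 S4} h : W ^+ 4 <= a ^+ 3 * (3 * W ^+ 2 + W / 16).
  by apply: le_trans h4 _; rewrite ler_wpM2l ?exprn_ge0 ?(ltW a0) // lerD2l.
exfalso.
(* The inequality is homogeneous in [W] and [a]; with [w = W / a] it reads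
   [w * (w ^+ 2 - 3 * a) <= 1 / 16]. *)
pose w := W / a.
have WE : W = w * a by rewrite /w divfK ?gt_eqF.
have w64 : 16 / 25 <= w by rewrite /w ler_pdivlMr.
have : a ^+ 4 * w ^+ 4 <= a ^+ 4 * (3 * a * w ^+ 2 + w / 16).
  have -> : a ^+ 4 * w ^+ 4 = W ^+ 4 by rewrite WE; ring.
  apply: (le_trans h); rewrite WE le_eqVlt; apply/orP; left; apply/eqP; ring.
rewrite ler_pM2l ?exprn_gt0 // => {h}.
clear -w64 a1 => h.
have w0 : 0 < w by lra.
have w2 : (16 / 25) ^+ 2 <= w ^+ 2 by rewrite !expr2; apply: ler_pM => //; lra.
have : w * (w * (w ^+ 2 - 3 * a)) <= w / 16 by lra.
rewrite ler_pM2l //; apply/negP; rewrite -ltNge.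
have : 16 / 25 * (w ^+ 2 - 3 * a) <= w * (w ^+ 2 - 3 * a).
  by rewrite ler_wpM2r // subr_ge0; lra.
lra.
Qed.

End Influential.

(** * Tail estimates *)

Section Tails.
Local Open Scope ring_scope.
Variables (R : realFieldType) (T : finType).
Implicit Types (p x : R) (X V A : {set T}) (k l n : nat).

Lemma bernoulli x n : -1 <= x -> 1 + n%:R * x <= (1 + x) ^+ n.
Proof.
move=> x1; elim: n => [|n IHn]; first by rewrite mul0r addr0 expr0.
rewrite exprS; apply: (@le_trans _ _ ((1 + x) * (1 + n%:R * x))).
  rewrite -natr1; have : 0 <= n%:R * x ^+ 2 by rewrite mulr_ge0 ?sqr_ge0.
  by clear IHn; lra.
by rewrite ler_wpM2l //; clear IHn; lra.
Qed.

Lemma chebyshev_lower p V l : 0 <= p <= 1 -> l%:R < p * #|V|%:R ->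
  (p * #|V|%:R - l%:R) ^+ 2 * (1 - prob p (fun X => (l <= #|X :&: V|)%N)) <= p * #|V|%:R.
Proof.
move=> p01 lV; have /andP[p0 p1] := p01.
pose L := linear_form p (fun z => (z \in V)%:R) (index_enum T).
have cardE (A : {set T}) : #|A|%:R = \sum_z (z \in A)%:R :> R.
  by rewrite -sum1_card natr_sum big_mkcond; apply: eq_bigr => z _; case: (z \in A).
have LE X : L X = #|X :&: V|%:R - p * #|V|%:R.
  rewrite !cardE mulr_sumr -sumrB; apply: eq_bigr => z _.
  by rewrite /centred inE; case: (z \in V); case: (z \in X) => /=; ring.
have L2 : expect p (fun X => L X ^+ 2) <= p * #|V|%:R.
  rewrite (second_moment _ _ (index_enum_uniq T)) cardE -[leLHS]mulrA ler_wpM2l // -[leRHS]mul1r.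
  rewrite (_ : \sum_z _ = \sum_z (z \in V)%:R).
    by rewrite ler_wpM2r ?sumr_ge0 //; lra.
  by apply: eq_bigr => z _; case: (z \in V); rewrite ?expr1n ?expr0n.
rewrite -probC -expectZ; apply: le_trans L2; apply: le_expect => // X.
rewrite LE -ltnNge; case: ltnP => [Xl|_]; last by rewrite mulr0 sqr_ge0.
rewrite mulr1 -[leRHS]sqrrN opprB.
have Xl' : #|X :&: V|%:R <= l%:R :> R by rewrite ler_nat ltnW.
by rewrite lerXn2r ?nnegrE ?subr_ge0 //; [apply: ltW | lra | lra].
Qed.

Lemma size_concentration k l V p : (l <= k)%N -> 10 * (1000 * 1000) <= k%:R :> R ->
  0 <= p <= 1 -> p * #|V|%:R = 201 / 200 * k%:R ->
  199 / 200 <= prob p (fun X => (l <= #|X :&: V|)%N).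
Proof.
move=> lk k7 p01 pV.
have lk' : l%:R <= k%:R :> R by rewrite ler_nat.
have k0 : 0 < k%:R :> R by apply: lt_le_trans k7; rewrite !mulr_gt0.
have := chebyshev_lower (V := V) (l := l) p01; rewrite pV => /(_ ltac:(lra)).
set pr := prob _ _; have pr1 : pr <= 1 by apply: prob_le1.
move=> h; have : (k%:R / 200) ^+ 2 * (1 - pr) <= 201 / 200 * k%:R.
  apply: le_trans h; rewrite ler_wpM2r ?subr_ge0 //.
  by rewrite lerXn2r ?nnegrE //; lra.
rewrite expr2 [X in X <= _](_ : _ = k%:R * (k%:R * (1 - pr) / (200 * 200))); last by field.
rewrite [leRHS]mulrC ler_pM2l // => h2.
have : 10 * (1000 * 1000) * (1 - pr) <= k%:R * (1 - pr) by rewrite ler_wpM2r ?subr_ge0.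
clear -h2; lra.
Qed.

Lemma prob_disjoint p A : prob p (fun X => [disjoint X & A]) = (1 - p) ^+ #|A|.
Proof.
rewrite -[1 - p]add0r -(mulr0 p) -binomial_mean_exp -expect_card.
by apply: eq_expect => X; rewrite -setI_eq0 -cards_eq0 expr0n.
Qed.

(** Markov's inequality for the variable [4^-1 ^+ #|X :&: V|]. With mean [4 * k]
    the failure probability is [2^-1 ^+ k], small against the probability that
    a random set avoids a given [k]-set. *)
Lemma chernoff_lower k l V : (l <= k)%N -> (0 < k)%N -> (4 * k <= #|V|)%N ->
  1 - 2^-1 ^+ k <= prob (4 * k%:R / #|V|%:R : R) (fun X => (l <= #|X :&: V|)%N).
Proof.
move=> lk k0 kV; set N := #|V|; set p := (4 * k%:R / N%:R : R).
have N0 : 0 < N%:R :> R by rewrite ltr0n; lia.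
have p01 : 0 <= p <= 1.
  rewrite divr_ge0 ?mulr_ge0 //= ler_pdivrMr // mul1r -natrM ler_nat.
  by rewrite /N; lia.
suff : prob p (fun X => ~~ (l <= #|X :&: V|)%N) <= 2^-1 ^+ k by rewrite probC; lra.
apply: (@le_trans _ _ (expect p (fun X => 4 ^+ k * 4^-1 ^+ #|X :&: V|))).
  apply: le_expect => // X; rewrite -ltnNge; case: ltnP => [Xl|_]; last first.
    by rewrite mulr_ge0 ?exprn_ge0 ?invr_ge0.
  rewrite -(subnK (leq_trans (ltnW Xl) lk)) exprD -mulrA -exprMn divff ?pnatr_eq0 //.
  by rewrite expr1n mulr1 exprn_ege1 // ler1n.
rewrite (expectZ p (4 ^+ k)) (expect_card p V (fun m => 4^-1 ^+ m)) binomial_mean_exp -/N.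
have -> : p * 4^-1 + (1 - p) = 1 - 3 * k%:R / N%:R.
  by rewrite /p; field; rewrite gt_eqF.
have half : (1 - N%:R^-1) ^+ N <= 2^-1 :> R.
  have N1 : 1 <= N%:R :> R by rewrite ler1n -(ltr0n R).
  have V0 : 0 < N%:R^-1 :> R by rewrite invr_gt0.
  have V1 : N%:R^-1 <= 1 :> R by rewrite invf_le1.
  rewrite -[leRHS]mul1r ler_pdivlMr // mulrC.
  apply: (@le_trans _ _ ((1 + N%:R^-1) ^+ N * (1 - N%:R^-1) ^+ N)).
    rewrite ler_wpM2r ?exprn_ge0 ?subr_ge0 //.
    apply: le_trans (bernoulli _ _); last by lra.
    by rewrite divff ?gt_eqF.
  by rewrite -exprMn exprn_ile1 //; nra.
have base : 1 - 3 * k%:R / N%:R <= (1 - N%:R^-1) ^+ (3 * k) :> R.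
  apply: le_trans (bernoulli _ _).
    by rewrite natrM mulrN.
  by rewrite lerN2 invf_le1 // ler1n -(ltr0n R).
have b0 : 0 <= 1 - 3 * k%:R / N%:R :> R.
  rewrite subr_ge0 ler_pdivrMr // mul1r -natrM ler_nat /N; lia.
have : (1 - 3 * k%:R / N%:R) ^+ N <= (2^-1 ^+ 3) ^+ k :> R.
  apply: (@le_trans _ _ (((1 - N%:R^-1) ^+ (3 * k)) ^+ N)).
    by rewrite lerXn2r ?nnegrE // (le_trans b0).
  rewrite exprAC exprM lerXn2r ?nnegrE ?exprn_ge0 ?subr_ge0 ?invf_le1 ?invr_ge0 //.
    by rewrite ler1n -(ltr0n R).
  by rewrite lerXn2r ?nnegrE ?exprn_ge0 ?subr_ge0 ?invf_le1 ?invr_ge0 ?ler1n -?(ltr0n R).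
move=> h; apply: (@le_trans _ _ (4 ^+ k * (2^-1 ^+ 3) ^+ k)).
  by rewrite ler_wpM2l ?exprn_ge0.
by rewrite -exprMn (_ : 4 * _ = 2^-1) //; field.
Qed.

End Tails.

(** * Binomial coefficients in the range n > 12k *)

Section Range.
Local Open Scope ring_scope.
Variables (R : realFieldType) (k n : nat).
Hypothesis k_large : 10 * (1000 * 1000) <= k%:R :> R.
Hypothesis n_large : (12 * k < n)%N.

(** Slightly more than [k / (n - 2)], so that a random set contains at least [k]
    elements outside a given pair with probability at least [199 / 200]. *)
Definition bias : R := 201 / 200 * k%:R / (n - 2)%:R.

Let N := (n - 2)%N.
Let p := bias.

Lemma k_gt0 : 0 < k%:R :> R.
Proof. by apply: lt_le_trans k_large; rewrite !mulr_gt0. Qed.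

Lemma k_ge j : (j <= 1000)%N -> (j <= k)%N.
Proof.
move=> j1000; rewrite -(ler_nat R); apply: le_trans k_large.
apply: (@le_trans _ _ 1000); first by rewrite (ler_nat R j 1000).
by lra.
Qed.

Lemma N_lower : 12 * k%:R - 1 <= N%:R :> R.
Proof.
have kn : (12 * k <= N.+1)%N by move: (@k_ge 2 isT) n_large; rewrite /N; lia.
by rewrite lerBlDr natr1 -natrM ler_nat.
Qed.

Lemma N_gt0 : 0 < N%:R :> R.
Proof.
by have := N_lower; have := k_large; lra.
Qed.

Lemma bias_bounds : 0 < p <= 21 / 250.
Proof.
have c0 : 0 < 201 / 200 :> R by lra.
apply/andP; split; first exact: divr_gt0 (mulr_gt0 c0 k_gt0) N_gt0.
rewrite /p /bias -/N.
by rewrite ler_pdivrMr ?N_gt0 //; have := N_lower; have := k_large; lra.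
Qed.

Lemma biasN : p * N%:R = 201 / 200 * k%:R.
Proof. by rewrite /p /bias divfK // gt_eqF ?N_gt0. Qed.

Lemma bin_shift1 : (k%:R - 1) * 'C(N, k - 1)%:R = (N%:R - k%:R + 2) * 'C(N, k - 2)%:R :> R.
Proof.
have k2 := @k_ge 2 isT; have kN : (k <= N)%N by move: n_large; rewrite /N; lia.
have := mul_bin_left N (k - 2); rewrite (_ : (k - 2).+1 = (k - 1)%N); last by lia.
move/(congr1 (fun m => m%:R : R)); rewrite !natrM.
have -> : (k - 1)%:R = k%:R - 1 :> R by rewrite natrB //; lia.
have -> // : (N - (k - 2))%:R = N%:R - k%:R + 2 :> R.
by rewrite -natrB // -natrD; congr _%:R; lia.
Qed.

Lemma bin_shift2 : k%:R * 'C(N, k)%:R = (N%:R - k%:R + 1) * 'C(N, k - 1)%:R :> R.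
Proof.
have k2 := @k_ge 2 isT; have kN : (k <= N)%N by move: n_large; rewrite /N; lia.
have := mul_bin_left N (k - 1); rewrite (_ : (k - 1).+1 = k); last by lia.
move/(congr1 (fun m => m%:R : R)); rewrite !natrM.
have -> // : (N - (k - 1))%:R = N%:R - k%:R + 1 :> R.
by rewrite -natrB // natr1; congr _%:R; lia.
Qed.

Lemma k_le_N : (k <= N)%N.
Proof. by have := @k_ge 2 isT; move: n_large; rewrite /N; lia. Qed.

Lemma bin_gt0_layer l : (l <= k)%N -> 0 < 'C(N, l)%:R :> R.
Proof. by move=> lk; rewrite ltr0n bin_gt0 (leq_trans lk) // k_le_N. Qed.

(** [(k / N) ^+ 2 * 'C(N, k)] is about ['C(N, k - 2)]; the factor [51 / 50] absorbs
    the error terms. *)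
Lemma bias2_bin : p ^+ 2 * 'C(N, k)%:R <= 51 / 50 * 'C(N, k - 2)%:R.
Proof.
have [k0 N0] := (k_gt0, N_gt0).
have k1 : 1 < k%:R :> R by have := k_large; lra.
have kN : k%:R <= N%:R :> R by rewrite ler_nat k_le_N.
have C0 := bin_gt0_layer (leq_subr 2 k).
have eqC : k%:R * (k%:R - 1) * 'C(N, k)%:R =
    (N%:R - k%:R + 1) * (N%:R - k%:R + 2) * 'C(N, k - 2)%:R :> R.
  rewrite mulrAC bin_shift2 mulrAC -mulrA [_ * 'C(N, k - 1)%:R]mulrC.
  by rewrite -mulrA [_ * (k%:R - 1)]mulrC bin_shift1; ring.
have leC : k%:R * (k%:R - 1) * 'C(N, k)%:R <= N%:R ^+ 2 * 'C(N, k - 2)%:R :> R.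
  rewrite eqC ler_wpM2r ?(ltW C0) // expr2 ler_pM //; have := k_large; lra.
rewrite -(ler_pM2l (exprn_gt0 2 N0)) mulrA -exprMn [N%:R * p]mulrC biasN.
have kk : (201 / 200 * k%:R) ^+ 2 <= 51 / 50 * (k%:R * (k%:R - 1)) :> R.
  rewrite expr2 -subr_ge0 [X in 0 <= X](_ : _ = k%:R * (399 / (200 * 200) * k%:R - 51 / 50)); last by field.
  by rewrite mulr_ge0 ?(ltW k0) // subr_ge0; have := k_large; lra.
apply: (@le_trans _ _ (51 / 50 * (k%:R * (k%:R - 1)) * 'C(N, k)%:R)).
  by rewrite ler_wpM2r.
by move: leC; lra.
Qed.

(** [(1 - k / N) * 'C(N, k - 2)] is about ['C(N - 1, k - 2)], the size of a star in
    the layer [k - 1], and the density of such a star is about [k / N]. The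
    numbers [1 / 1000] and [49 / 50] leave room for the error terms. *)
Lemma bias_density (m : R) :
  (1 - (k%:R / N%:R + 1 / 1000)) * 'C(N, k - 2)%:R <= m ->
  49 / 50 * p * 'C(N, k - 1)%:R <= 199 / 200 * m.
Proof.
move=> hm; have [k0 N0] := (k_gt0, N_gt0).
have C0 := bin_gt0_layer (leq_subr 2 k).
have k1 : 0 < k%:R - 1 :> R by have := k_large; lra.
apply: (@le_trans _ _ (199 / 200 * ((1 - (k%:R / N%:R + 1 / 1000)) * 'C(N, k - 2)%:R))); last first.
  by rewrite ler_wpM2l //; lra.
rewrite -(ler_pM2l k1) mulrCA bin_shift1.
rewrite -(ler_pM2l N0).
have -> : N%:R * (49 / 50 * p * ((N%:R - k%:R + 2) * 'C(N, k - 2)%:R)) =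
   49 / 50 * (p * N%:R) * (N%:R - k%:R + 2) * 'C(N, k - 2)%:R by ring.
rewrite biasN.
have -> : N%:R * ((k%:R - 1) * (199 / 200 * ((1 - (k%:R / N%:R + 1 / 1000)) * 'C(N, k - 2)%:R)))
  = 199 / 200 * (k%:R - 1) * (999 / 1000 * N%:R - k%:R) * 'C(N, k - 2)%:R :> R.
  by field; rewrite gt_eqF.
rewrite ler_wpM2r ?(ltW C0) //.
have := N_lower; have := k_large; move: k%:R N%:R => a b ha hb.
have hb' : 11 * a <= b by lra.
have h1 : 0 <= (b - 11 * a) * (a - 100 * 1000) by rewrite mulr_ge0; lra.
have h2 : 0 <= (a - 1000 * 1000) * (a - 1000 * 1000) by rewrite mulr_ge0; lra.
nra.
Qed.

End Range.

(** * The family seen from a pair of elements *)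

Section Families.
Local Open Scope ring_scope.
Variables (R : archiRealFieldType) (T : finType) (k : nat) (F : {set {set T}}).
Hypothesis k_large : 10 * (1000 * 1000) <= k%:R :> R.
Hypothesis n_large : (12 * k < #|T|)%N.
Hypothesis F_uniform : forall A, A \in F -> #|A| = k.
Hypothesis F_int : forall A B, A \in F -> B \in F -> A :&: B != set0.

Implicit Types (x y z l : T) (A B D X Y : {set T}) (U : {set {set T}}).

Definition star x := [set A in F | x \in A].
Definition both x y := [set A in F | (x \in A) && (y \in A)].
Definition only x y := [set A in F | (x \in A) && (y \notin A)].
Definition neither x y := [set A in F | (x \notin A) && (y \notin A)].
(** Removing the pair [D = [set x; y]] turns [both x y], [only x y] and
    [neither x y] into uniform families on the same [n - 2] elements, of ranks
    [k - 2], [k - 1] and [k]. *)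
Definition trace D U := [set A :\: D | A in U].

Let N := (#|T| - 2)%N.
Let p : R := bias R k #|T|.
Let C0 : R := 'C(N, k - 2)%:R.

Let p_bounds : 0 < p <= 21 / 250 := bias_bounds k_large n_large.
Let p_gt0 : 0 < p. Proof. by have /andP[] := p_bounds. Qed.
Let p_le : p <= 21 / 250. Proof. by have /andP[] := p_bounds. Qed.
Let p_in01 : 0 < p < 1.
Proof. by rewrite p_gt0 /=; apply: le_lt_trans p_le _; lra. Qed.
Let p01 : 0 <= p <= 1.
Proof. by have /andP[h1 h2] := p_in01; rewrite !ltW. Qed.
Let C0_gt0 : 0 < C0 := bin_gt0_layer k_large n_large (leq_subr 2 k).

Lemma card_trace D P U : (forall A, A \in U -> A :&: D = P) -> #|trace D U| = #|U|.
Proof.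
move=> UP; apply: card_in_imset => A B AU BU AB.
by rewrite -(setID A D) -(setID B D) AB !UP.
Qed.

Lemma card_both_trace x y : x != y -> #|trace [set x; y] (both x y)| = #|both x y|.
Proof.
move=> xy; apply: (@card_trace _ [set x; y]) => A; rewrite inE => /and3P[_ xA yA].
by apply/setIidPr/subsetP => z; rewrite !inE => /orP[] /eqP->.
Qed.

Lemma card_only_trace x y : x != y -> #|trace [set x; y] (only x y)| = #|only x y|.
Proof.
move=> xy; apply: (@card_trace _ [set x]) => A; rewrite inE => /and3P[_ xA yA].
apply/setP=> z; rewrite !inE; case: (eqVneq z x) => [->|zx]; first by rewrite xA.
by case: eqP => [->|_]; rewrite ?andbF // (negbTE yA).
Qed.

Lemma trace_sub D U A : A \in trace D U -> A \subset ~: D.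
Proof. by case/imsetP=> B _ ->; rewrite setDE subsetIr. Qed.

Lemma card_compl2 x y : x != y -> #|~: [set x; y]| = N.
Proof. by move=> xy; rewrite /N -(cardsC [set x; y]) cards2 xy addKn. Qed.

Lemma card_in_both_trace x y A : x != y -> A \in trace [set x; y] (both x y) ->
  A \subset ~: [set x; y] /\ #|A| = (k - 2)%N.
Proof.
move=> xy hA; split; first exact: trace_sub hA.
case/imsetP: hA => B; rewrite inE => /and3P[BF xB yB] ->.
rewrite cardsD (setIidPr _) ?cards2 ?xy ?F_uniform //.
by apply/subsetP => z; rewrite !inE => /orP[] /eqP->.
Qed.

Lemma card_in_only_trace x y A : x != y -> A \in trace [set x; y] (only x y) ->
  A \subset ~: [set x; y] /\ #|A| = (k - 1)%N.
Proof.
move=> xy hA; split; first exact: trace_sub hA.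
case/imsetP: hA => B; rewrite inE => /and3P[BF xB yB] ->.
rewrite cardsD (_ : B :&: _ = [set x]) ?cards1 ?F_uniform //.
apply/setP=> z; rewrite !inE; case: (eqVneq z x) => [->|zx]; first by rewrite xB.
by case: eqP => [->|_]; rewrite ?andbF // (negbTE yB).
Qed.

Lemma card_in_neither x y A : A \in neither x y ->
  A \subset ~: [set x; y] /\ #|A| = k.
Proof.
rewrite inE => /and3P[AF xA yA]; split; last exact: F_uniform.
apply/subsetP=> z zA; rewrite !inE; apply/norP; split.
  by apply: contraNneq xA => <-.
by apply: contraNneq yA => <-.
Qed.

Lemma up_closure_density x y (j : nat) U : x != y -> (j <= k)%N ->
  (forall A, A \in U -> A \subset ~: [set x; y] /\ #|A| = j) ->
  199 / 200 * #|U|%:R <= prob p (up_closure U) * 'C(N, j)%:R.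
Proof.
move=> xy lk UV; have cV := card_compl2 xy.
rewrite -cV; apply: le_trans (prob_up_closure p01 UV).
rewrite mulrC ler_wpM2l //; apply: size_concentration lk k_large p01 _.
by rewrite cV biasN.
Qed.

Lemma up_closure_cross_int U U' :
  (forall A B, A \in U -> B \in U' -> A :&: B != set0) ->
  cross_int (up_closure U) (up_closure U').
Proof.
move=> UU' X Y /existsP[A /andP[AU AX]] /existsP[B /andP[BU' BY]].
have /set0Pn[z zAB] := UU' _ _ AU BU'; apply/set0Pn; exists z.
exact: subsetP (setISS AX BY) _ zAB.
Qed.

Lemma trace_cross_int D U U' : U \subset F -> U' \subset F ->
  (forall A B z, A \in U -> B \in U' -> z \in D -> z \in A -> z \in B -> False) ->
  forall A B, A \in trace D U -> B \in trace D U' -> A :&: B != set0.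
Proof.
move=> /subsetP UF /subsetP U'F disj _ _ /imsetP[A AU ->] /imsetP[B BU' ->].
have /set0Pn[z] := F_int (UF _ AU) (U'F _ BU'); rewrite inE => /andP[zA zB].
apply/set0Pn; exists z; rewrite !inE zA zB !andbT; apply/andP; split;
  by apply/negP => zD; apply: disj AU BU' zD zA zB.
Qed.

Lemma trace_neither x y : trace [set x; y] (neither x y) = neither x y.
Proof.
rewrite /trace -[RHS]imset_id; apply: eq_in_imset => A /card_in_neither[Axy _].
by apply/setDidPl; rewrite disjoints_subset.
Qed.

(** Members through [x] and [l] meet those avoiding both of them outside the pair,
    so [cross_int_small] applies with [c = 2 / 5] and [s = 9]. *)
Lemma dense_link_small_rest x l : x != l -> 13 / 20 * C0 <= #|both x l|%:R ->
  #|neither x l|%:R <= 3 * p ^+ 9 * 'C(N, k)%:R.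
Proof.
move=> xl dense.
pose E := up_closure (trace [set x; l] (both x l)).
pose E' := up_closure (neither x l).
have EE' : cross_int E E'.
  apply: up_closure_cross_int; rewrite -trace_neither; apply: trace_cross_int.
  - by apply/subsetP=> A; rewrite inE => /andP[].
  - by apply/subsetP=> A; rewrite inE => /andP[].
  - move=> A B z _; rewrite !inE => /and3P[_ xB lB] /orP[]/eqP-> _ zB.
      by rewrite zB in xB.
    by rewrite zB in lB.
have hE : 1 - 2 / 5 <= prob p E.
  have := up_closure_density xl (leq_subr 2 k) (fun A => @card_in_both_trace x l A xl).
  rewrite card_both_trace // -/E -/C0 => h.
  rewrite -(ler_pM2r C0_gt0); apply: le_trans h; move: dense (ltW C0_gt0).
  by move: #|_|%:R C0; move=> a b; lra.
have hc : 2 / 5 <= (1 - p) ^+ 9.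
  apply: (@le_trans _ _ ((229 / 250) ^+ 9)); first by lra.
  by rewrite lerXn2r ?nnegrE //; move: p_le; lra.
have c0 : 0 < 2 / 5 :> R by lra.
have := cross_int_small EE' (@up_closure_upset _ _) p_in01 c0 hc hE.
have := up_closure_density xl (leqnn k) (@card_in_neither x l).
rewrite -/E'; have := ltW (bin_gt0_layer k_large n_large (leqnn k)); rewrite -/N.
move: (prob p E') => e; move: #|_|%:R 'C(N, k)%:R => a c c00 h1 h2.
have h3 : e * c <= p ^+ 9 / (2 / 5) * c by rewrite ler_wpM2r.
have h4 : 0 <= p ^+ 9 * c by rewrite mulr_ge0 // exprn_ge0 // ltW.
have e1 : p ^+ 9 / (2 / 5) * c = 5 / 2 * (p ^+ 9 * c) by field.
rewrite e1 in h3; rewrite -mulrA; move: h1 h3 h4.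
by move: (p ^+ 9 * c) (e * c) => u v; lra.
Qed.


Lemma influence_outside U z : (forall A, A \in U -> z \notin A) ->
  influence p (fun X => (up_closure U X)%:R) z = 0.
Proof.
move=> Uz; rewrite -(expect_cst T p 0); apply: eq_expect => X.
apply/eqP; rewrite subr_eq0; apply/eqP; congr (nat_of_bool _)%:R.
apply: eq_existsb => A; case AU: (A \in U) => //=; rewrite subsetD1 (Uz _ AU) andbT.
by rewrite -subDset [A :\: [set z]](_ : _ = A) //; apply/setDidPl; rewrite disjoint_sym disjoints1 Uz.
Qed.

(** [cross_int_influential] yields an element [z] such that the sets [X] with
    [z |: X] in the first up-closure have measure at least [1 / 4]. These sets
    cross-intersect the members avoiding both [i] and [z], and
    [cross_int_small] applies with [c = 3 / 4] and [s = 3]. *)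
Lemma influential_rest i j : i != j ->
  49 / 50 * p <= prob p (up_closure (trace [set i; j] (only i j))) ->
  prob p (up_closure (trace [set i; j] (only i j))) <=
    prob p (up_closure (trace [set i; j] (only j i))) ->
  exists2 z, z \notin [set i; j] & #|neither i z|%:R <= 3 / 25 * C0.
Proof.
move=> ij; set E := up_closure _; set E' := up_closure _ => pE EE'p.
have EE' : cross_int E E'.
  apply: up_closure_cross_int; apply: trace_cross_int.
  - by apply/subsetP=> A; rewrite inE => /andP[].
  - by apply/subsetP=> A; rewrite inE => /andP[].
  - move=> A B z; rewrite !inE => /and3P[_ iA jA] /and3P[_ jB iB] /orP[]/eqP-> zA zB.
      by rewrite zB in iB.
    by rewrite zA in jA.
have [z hz] := cross_int_influential EE' (@up_closure_upset _ _) p_bounds pE EE'p.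
have zij : z \notin [set i; j].
  apply/negP=> zD; move: hz; rewrite influence_outside; first by lra.
  by move=> A /trace_sub/subsetP AD; apply/negP=> /AD; rewrite inE zD.
exists z => //; have iz : i != z.
  by apply: contraNneq zij => <-; rewrite !inE eqxx.
pose Ez X := E (z |: X).
have EzB : cross_int Ez (up_closure (neither i z)).
  move=> X Y /existsP[_ /andP[/imsetP[A + ->] AX]] /existsP[B /andP[+ BY]].
  rewrite !inE => /and3P[AF iA jA] /and3P[BF iB zB].
  have /set0Pn[w] := F_int AF BF; rewrite inE => /andP[wA wB].
  have wi : w != i by apply: contraNneq iB => <-.
  have wj : w != j by apply: contraNneq jA => <-.
  have wz : w != z by apply: contraNneq zB => <-.
  have := subsetP AX w; rewrite !inE (negbTE wi) (negbTE wj) (negbTE wz) wA /=.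
  by move=> /(_ isT) wX; apply/set0Pn; exists w; rewrite inE wX (subsetP BY).
have hEz : 1 - 3 / 4 <= prob p Ez.
  apply: (@le_trans _ _ (1 / 4)); first by lra.
  apply: le_trans hz _; apply: le_expect => // X.
  by rewrite lerBlDr lerDl ler0n.
have hc : 3 / 4 <= (1 - p) ^+ 3.
  apply: (@le_trans _ _ ((229 / 250) ^+ 3)); first by lra.
  by rewrite lerXn2r ?nnegrE //; move: p_le; lra.
have c0 : 0 < 3 / 4 :> R by lra.
have := cross_int_small EzB (@up_closure_upset _ _) p_in01 c0 hc hEz.
have := up_closure_density iz (leqnn k) (@card_in_neither i z).
have := ltW (bin_gt0_layer k_large n_large (leqnn k)); rewrite -/N.
have := bias2_bin k_large n_large; rewrite -/N -/p -/C0.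
move: (prob p _) => e; move: #|_|%:R 'C(N, k)%:R => a c hc2 c00 h1 h2.
have h3 : e * c <= p ^+ 3 / (3 / 4) * c by rewrite ler_wpM2r.
have e1 : p ^+ 3 / (3 / 4) * c = 4 / 3 * (p * (p ^+ 2 * c)) by field.
have h4 : p * (p ^+ 2 * c) <= 21 / 250 * (51 / 50 * C0).
  by rewrite ler_pM // ?(ltW p_gt0) // mulr_ge0 ?sqr_ge0.
move: h1 h3 h4; rewrite e1; move: (p * _) (e * c) (ltW C0_gt0) => u v.
by move: C0 => d; lra.
Qed.

End Families.

(** * Variance of the intersection with a fixed set *)

Section Counting.
Variables (T : finType) (k : nat).
Implicit Types (A D S : {set T}) (Q : {set {set T}}).

Lemma card_supersets D : #|D| <= k ->
  #|[set A : {set T} | D \subset A & #|A| == k]| = 'C(#|T| - #|D|, k - #|D|).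
Proof.
move=> Dk; have <- : #|~: D| = #|T| - #|D| by rewrite -(cardsC D) addKn.
rewrite -cards_draws -(card_in_imset (f := fun A => A :\: D)).
  congr #|pred_of_set _|; apply/setP=> B; rewrite inE; apply/imsetP/andP.
    move=> [A]; rewrite inE => /andP[DA /eqP Ak] ->.
    by rewrite setDE subsetIr -setDE cardsD (setIidPr DA) Ak.
  move=> [BD /eqP Bk]; exists (B :|: D).
    rewrite inE subsetUr cardsU.
    have /eqP-> : B :&: D == set0 by rewrite setI_eq0 disjoints_subset.
    by rewrite cards0 subn0 Bk subnK /=.
  by rewrite setDUl setDv setU0; apply/esym/setDidPl; rewrite disjoints_subset.
move=> A B; rewrite !inE => /andP[DA _] /andP[DB _] AB.
by rewrite -(setID A D) -(setID B D) AB (setIidPr DA) (setIidPr DB).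
Qed.

Lemma sum_card_setI Q S :
  \sum_(A in Q) #|A :&: S| = \sum_(j in S) #|[set A in Q | j \in A]|.
Proof.
rewrite (eq_bigr (fun A : {set T} => \sum_(j in S) (j \in A))); last first.
  move=> A _; rewrite -sum1_card big_mkcond /= [RHS]big_mkcond.
  by apply: eq_bigr => j _; rewrite inE; case: (j \in A); case: (j \in S).
rewrite exchange_big; apply: eq_bigr => j _.
by rewrite -sum1dep_card [RHS]big_mkcondr; apply: eq_bigr => A _; case: ifP.
Qed.

Lemma sum_card_setI_sqr Q S :
  \sum_(A in Q) #|A :&: S| ^ 2 =
  \sum_(i in S) \sum_(j in S) #|[set A in Q | (i \in A) && (j \in A)]|.
Proof.
rewrite (eq_bigr (fun A : {set T} => \sum_(i in S) \sum_(j in S) (i \in A) * (j \in A))); last first.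
  move=> A _; rewrite -mulnn -sum1_card big_mkcond /=.
  rewrite (_ : \sum_i _ = \sum_(i in S) (i \in A)); first by rewrite big_distrlr.
  by rewrite [RHS]big_mkcond; apply: eq_bigr => j _; rewrite inE; case: (j \in A); case: (j \in S).
rewrite exchange_big; apply: eq_bigr => i _; rewrite exchange_big; apply: eq_bigr => j _.
rewrite -sum1dep_card [RHS]big_mkcondr; apply: eq_bigr => A _.
by case: (i \in A); case: (j \in A).
Qed.

End Counting.

Section Variance.
Local Open Scope ring_scope.
Variables (R : realFieldType) (T : finType) (k : nat).
Hypothesis k_ge3 : (3 <= k)%N.
Hypothesis k_le : (k <= #|T|)%N.
Variables (i : T) (S : {set T}).
Hypothesis iS : i \notin S.

Let n := #|T|.
Let Q := [set A : {set T} | (i \in A) && (#|A| == k)].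
Let C0 : R := 'C(n - 2, k - 2)%:R.

(** The variance of a hypergeometric variable is at most its mean. Double
    counting gives the first two moments in terms of ['C(n - 2, k - 2)] and
    ['C(n - 3, k - 3)], and the ratio of the latter to the former is at most
    [(k - 1) / (n - 1)]. *)
Lemma sum_hypergeometric_sqr_dev :
  \sum_(A in Q) (#|A :&: S|%:R - #|S|%:R * ((k%:R - 1) / (n%:R - 1))) ^+ 2
    <= #|S|%:R * C0.
Proof.
set s : R := #|S|%:R; set m := s * (_ / _).
have n1 : 0 < n%:R - 1 :> R by rewrite subr_gt0 ltr1n; apply: leq_trans k_le; apply: ltnW.
have cQ : #|Q| = 'C(n - 1, k - 1).
  rewrite -(cards1 i) -card_supersets ?cards1; last by lia.
  by apply: eq_card => A; rewrite !inE sub1set.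
have c1 j : j \in S -> #|[set A in Q | j \in A]| = 'C(n - 2, k - 2).
  move=> jS; have ij : i != j by apply: contraNneq iS => ->.
  have c2 : #|[set i; j]| = 2%N by rewrite cards2 ij.
  rewrite -c2 -card_supersets ?c2; last by lia.
  apply: eq_card => A; rewrite !inE subUset !sub1set.
  by case: (i \in A); case: (j \in A); rewrite ?andbF ?andbT.
have c2 j l : j \in S -> l \in S -> j != l ->
    #|[set A in Q | (j \in A) && (l \in A)]| = 'C(n - 3, k - 3).
  move=> jS lS jl; have ij : i != j by apply: contraNneq iS => ->.
  have il : i != l by apply: contraNneq iS => ->.
  have c3 : #|i |: [set j; l]| = 3%N by rewrite cardsU1 !inE (negbTE ij) (negbTE il) cards2 jl.
  rewrite -c3 -card_supersets ?c3 //.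
  apply: eq_card => A; rewrite !inE !subUset !sub1set.
  by case: (i \in A); case: (j \in A); case: (l \in A); rewrite ?andbF ?andbT.
have S1 : \sum_(A in Q) #|A :&: S|%:R = s * C0.
  rewrite -natr_sum sum_card_setI (eq_bigr _ c1) sum_nat_const natrM //.
pose C3 : R := 'C(n - 3, k - 3)%:R.
have S2 : \sum_(A in Q) #|A :&: S|%:R ^+ 2 = s * C0 + s * (s - 1) * C3.
  rewrite (eq_bigr (fun A : {set T} => (#|A :&: S| ^ 2)%:R)); last by move=> A _; rewrite natrX.
  rewrite -natr_sum sum_card_setI_sqr natr_sum.
  rewrite (eq_bigr (fun=> C0 + (s - 1) * C3)).
    by rewrite sumr_const -mulr_natl -/s; ring.
  move=> j jS; rewrite (bigD1 j) //= natrD; congr (_ + _).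
    by rewrite /C0 -(c1 j jS); congr (_%:R); apply: eq_card => A; rewrite !inE andbb.
  rewrite (eq_bigr (fun=> 'C(n - 3, k - 3))); last first.
    by move=> l /andP[lS lj]; rewrite c2 // eq_sym.
  rewrite sum_nat_cond_const natrM; congr (_ * _).
  rewrite /s (cardD1 j S) jS natrD addrC addKr; congr (_%:R).
  by apply: eq_card => l; rewrite !inE andbC.
pose M : R := 'C(n - 1, k - 1)%:R.
have eM : (n%:R - 1) * C0 = (k%:R - 1) * M.
  have := mul_bin_diag (n - 1) (k - 2); rewrite (_ : (n - 1).-1 = (n - 2)%N); last by lia.
  rewrite (_ : (k - 2).+1 = (k - 1)%N); last by lia.
  move/(congr1 (fun m => m%:R : R)); rewrite !natrM !natrB //; lia.
have e3 : (n%:R - 1) * C3 <= (k%:R - 1) * C0.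
  have := mul_bin_diag (n - 2) (k - 3); rewrite (_ : (n - 2).-1 = (n - 3)%N); last by lia.
  rewrite (_ : (k - 3).+1 = (k - 2)%N); last by lia.
  have leC : ('C(n - 3, k - 3) <= 'C(n - 2, k - 2))%N.
    rewrite (_ : (n - 2)%N = (n - 3).+1); last by lia.
    rewrite (_ : (k - 2)%N = (k - 3).+1); last by lia.
    by rewrite binS leq_addl.
  move=> e; have -> : n%:R - 1 = (n - 1)%:R :> R by rewrite natrB //; lia.
  have -> : k%:R - 1 = (k - 1)%:R :> R by rewrite natrB //; lia.
  rewrite -!natrM ler_nat (_ : (n - 1)%N = (n - 2).+1); last by lia.
  rewrite (_ : (k - 1)%N = (k - 2).+1); last by lia.
  by rewrite !mulSn e leq_add2r.
have e4 : (n%:R - 1) * m = s * (k%:R - 1) by rewrite /m; field; rewrite gt_eqF.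
rewrite (eq_bigr (fun A : {set T} => #|A :&: S|%:R ^+ 2 + (m ^+ 2 + (- (2 * m)) * #|A :&: S|%:R))); last first.
  by move=> A _; ring.
have S1' : \sum_(A in Q) - (2 * m) * #|A :&: S|%:R = - (2 * m) * (s * C0).
  by rewrite -mulr_sumr S1.
rewrite !big_split /= S2 S1' sumr_const cQ -[m ^+ 2 *+ _]mulr_natl -/M.
rewrite -(ler_pM2l n1).
have -> : (n%:R - 1) * (s * C0 + s * (s - 1) * C3 + (M * m ^+ 2 + - (2 * m) * (s * C0))) =
   (n%:R - 1) * (s * C0) + s * (s - 1) * ((n%:R - 1) * C3) + M * m * ((n%:R - 1) * m)
    - 2 * s * C0 * ((n%:R - 1) * m) by ring.
have -> : M * m * ((n%:R - 1) * m) = s * (k%:R - 1) * s * C0.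
  rewrite e4; have -> : M * m * (s * (k%:R - 1)) = m * s * ((k%:R - 1) * M) by ring.
  rewrite -eM; have -> : m * s * ((n%:R - 1) * C0) = s * C0 * ((n%:R - 1) * m) by ring.
  by rewrite e4; ring.
rewrite e4.
have s0 : 0 <= s * (s - 1).
  rewrite /s; case: #|S| => [|j]; first by rewrite mul0r.
  by rewrite mulr_ge0 // subr_ge0 ler1n.
have := ler_wpM2l s0 e3.
have : 0 <= s * ((k%:R - 1) * C0).
  rewrite !mulr_ge0 // ?ler0n // subr_ge0 ler1n; lia.
move: (_ * C3) => c3.
lra.
Qed.

End Variance.

(** * Existence of a centre *)

Section Star.
Local Open Scope ring_scope.
Variables (R : archiRealFieldType) (T : finType) (k : nat) (F : {set {set T}}).
Hypothesis k_large : 10 * (1000 * 1000) <= k%:R :> R.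
Hypothesis n_large : (12 * k < #|T|)%N.
Hypothesis F_uniform : forall A, A \in F -> #|A| = k.
Hypothesis F_int : forall A B, A \in F -> B \in F -> A :&: B != set0.
Variable S : {set T}.
Hypothesis cardS : #|S| = k.+2.

Let N := (#|T| - 2)%N.
Let p : R := bias R k #|T|.
Let C0 : R := 'C(N, k - 2)%:R.
Let theta : R := k%:R / N%:R + 1 / 1000.

Hypothesis S_rich : forall l, l \in S -> C0 < #|star F l|%:R.

Let C0_gt0 : 0 < C0 := bin_gt0_layer k_large n_large (leq_subr 2 k).

Let theta_le : theta <= 17 / 200.
Proof.
have N0 := N_gt0 k_large n_large; have hN := N_lower k_large n_large.
suff : k%:R / N%:R <= 84 / 1000 :> R by rewrite /theta; lra.
by rewrite ler_pdivrMr //; move: hN k_large; rewrite -/N; lra.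
Qed.

(** Take [i] of minimal degree in [S]: a bound relative to the degree of [i] then
    holds relative to all the degrees. The members through [i] have density more
    than [(k - 1) / (n - 1)] among the [k]-sets through [i], so by Chebyshev's
    argument the mean of [#|A :&: S|] over them exceeds the expected value by
    at most the square root of [#|S|]. On average over [j], the proportion
    of members through [i] that contain [j] is thus at most
    [(k - 1) / (n - 1) + 1 / 1000]. *)
Lemma exists_sparse_pair : exists i j, [/\ i \in S, j \in S, i != j &
  forall l, l \in S -> #|both F i j|%:R <= theta * #|star F l|%:R].
Proof.
have /set0Pn[l0 l0S] : S != set0 by rewrite -card_gt0 cardS.
case: (arg_minnP (fun l => #|star F l|) l0S) => i iS0 i_min.
have {iS0} iS : i \in S by exact: iS0.
suff [j /andP[jS ij] hj] : exists2 j, (j \in S) && (i != j) &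
    #|both F i j|%:R <= theta * #|star F i|%:R.
  exists i, j; split=> // l lS; apply: le_trans hj _.
  rewrite ler_wpM2l ?ler_nat ?i_min // addr_ge0 ?divr_ge0 //.
case: (pickP (fun j => ((j \in S) && (i != j)) &&
    (#|both F i j|%:R <= theta * #|star F i|%:R))) => [j /andP[? ?]|none].
  by exists j.
exfalso.
pose S' := S :\ i; pose f : R := #|star F i|%:R; pose s : R := #|S'|%:R.
have iS' : i \notin S' by rewrite !inE eqxx.
have cS' : #|S'| = k.+1 by have := cardsD1 i S; rewrite iS cardS => -[].
pose m : R := s * ((k%:R - 1) / (#|T|%:R - 1)).
have f0 : 0 < f by apply: lt_trans (S_rich iS).
have s0 : 0 < s by rewrite /s cS'.
have k3 := k_ge k_large (isT : 3 <= 1000)%N.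
have kn : (k <= #|T|)%N by apply: leq_trans (k_le_N k_large n_large) (leq_subr _ _).
have var := sum_hypergeometric_sqr_dev R k3 kn iS'.
rewrite -/s -/m -/N -/C0 in var.
have big : s * (theta * f) <= \sum_(A in star F i) #|A :&: S'|%:R.
  rewrite -natr_sum sum_card_setI natr_sum mulr_natl -sumr_const.
  apply: ler_sum => j; rewrite !inE => /andP[ji jS].
  have := none j; rewrite jS eq_sym ji /= => /negbT; rewrite -ltNge => /ltW h.
  apply: le_trans h _; rewrite ler_nat; apply: subset_leq_card.
  by apply/subsetP=> A; rewrite !inE => /and3P[-> -> ->].
have dev : s * f / 1000 <= \sum_(A in star F i) (#|A :&: S'|%:R - m).
  rewrite sumrB sumr_const -[m *+ _]mulr_natl -/f.
  suff : f * m <= s * f * (k%:R / N%:R) by move: big; rewrite /theta; lra.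
  rewrite /m mulrCA mulrA ler_wpM2l ?mulr_ge0 ?(ltW s0) ?(ltW f0) //.
  have N0 := N_gt0 k_large n_large.
  have nN : #|T|%:R - 1 = N%:R + 1 :> R.
    by rewrite /N natrB; [ring | apply: leq_trans kn; apply: leq_trans k3].
  rewrite nN ler_pdivrMr ?addr_gt0 // mulrAC ler_pdivlMr //.
  have := ltW N0; have := ltW (k_gt0 k_large); rewrite -/N.
  by move: k%:R N%:R => a b a0 b0; lra.
have cs : (\sum_(A in star F i) (#|A :&: S'|%:R - m)) ^+ 2 <= f * (s * C0).
  have := @weighted_cauchy_schwarz R _ (mem (star F i)) (fun=> 1) (fun=> 1)
     (fun A : {set T} => #|A :&: S'|%:R - m) (fun _ _ => ler01).
  rewrite (eq_bigr (fun A : {set T} => #|A :&: S'|%:R - m)); last first.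
    by move=> A _; rewrite !mul1r.
  move=> h; apply: le_trans h _.
  rewrite (eq_bigr (fun=> 1)); last by move=> A _; rewrite expr1n mulr1.
  rewrite sumr_const -[1 *+ _]/(f) ler_wpM2l ?(ltW f0) //.
  apply: le_trans var; rewrite [leLHS](eq_bigr (fun A : {set T} => (#|A :&: S'|%:R - m) ^+ 2)); last first.
    by move=> A _; rewrite mul1r.
  rewrite [leLHS]big_mkcond [leRHS]big_mkcond /=; apply: ler_sum => A _.
  rewrite !inE; case AF: (A \in F) => /=; last by case: ifP => // _; apply: sqr_ge0.
  by rewrite (F_uniform AF) eqxx andbT.
have : (s * f / 1000) ^+ 2 <= f * (s * C0).
  have h0 : 0 <= s * f / 1000 by rewrite divr_ge0 // mulr_ge0 ?(ltW s0) ?(ltW f0).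
  by apply: le_trans cs; rewrite lerXn2r ?nnegrE // (le_trans h0 dev).
apply/negP; rewrite -ltNge.
rewrite [ltRHS](_ : _ = s * f * (s * f / (1000 * 1000))); last by field.
rewrite mulrA [f * s]mulrC ltr_pM2l ?mulr_gt0 //.
apply: lt_trans (S_rich iS) _; rewrite -/f mulrAC.
rewrite -[ltLHS]mul1r ltr_pM2r // ltr_pdivlMr ?mulr_gt0 // mul1r.
have : k%:R <= s by rewrite /s cS' ler_nat.
move: k_large; lra.
Qed.


(** A member avoiding [z] contains [i] and [j], or avoids one of them together
    with [z]. *)
Lemma card_star_le i j z l :
  (#|star F l| <= #|both F z l| + #|both F i j| + #|neither F i z| + #|neither F j z|)%N.
Proof.
apply: (@leq_trans #|both F z l :|: both F i j :|: neither F i z :|: neither F j z|).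
  apply: subset_leq_card; apply/subsetP=> A; rewrite !inE => /andP[-> ->] /=.
  by case: (z \in A); case: (i \in A); case: (j \in A).
rewrite !cardsU; lia.
Qed.

Lemma card_star_le_pair i j z :
  (#|star F j| <= #|both F z j| + #|both F i j| + #|neither F i z|)%N.
Proof.
apply: (@leq_trans #|both F z j :|: both F i j :|: neither F i z|).
  apply: subset_leq_card; apply/subsetP=> A; rewrite !inE => /andP[-> ->] /=.
  by case: (z \in A); case: (i \in A).
rewrite !cardsU; lia.
Qed.

Lemma neitherC x y : neither F x y = neither F y x.
Proof. by apply/setP=> A; rewrite !inE; case: (x \in A); rewrite ?andbF ?andbT. Qed.

Lemma bothC x y : both F x y = both F y x.
Proof. by apply/setP=> A; rewrite !inE [(x \in A) && _]andbC. Qed.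

(** The exponent 9 makes the bound smaller than [p ^+ 4 * 'C(N, k)] divided by
    [100 ^+ 2], which is what the final argument starts from. *)
Definition nearly_star z := forall l, l \in S -> l != z ->
  #|neither F z l|%:R <= 3 * p ^+ 9 * 'C(N, k)%:R.

(** Bootstrapping: few members avoid both [i] and [z], and few contain both [i]
    and [j], so most members through [j] pass through [z] and
    [dense_link_small_rest] shows that very few avoid both [j] and [z]. Then the
    same holds for every [l] in [S]. *)
Lemma nearly_star_of_small_rest i j z : i \in S -> j \in S -> i != j ->
  (forall l, l \in S -> #|both F i j|%:R <= theta * #|star F l|%:R) ->
  z \notin [set i; j] -> #|neither F i z|%:R <= 3 / 25 * C0 -> nearly_star z.
Proof.
move=> iS jS ij sparse zij small.
have both_le l : l \in S -> #|both F i j|%:R <= 17 / 200 * #|star F l|%:R :> R.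
  by move=> lS; apply: le_trans (sparse _ lS) _; rewrite ler_wpM2r.
have natrD4 (a b c d : nat) : (a + b + c + d)%:R = a%:R + b%:R + c%:R + d%:R :> R.
  by rewrite !natrD.
have zj : z != j by apply: contraNneq zij => ->; rewrite !inE eqxx orbT.
have dense_j : 13 / 20 * C0 <= #|both F z j|%:R.
  have := card_star_le_pair i j z; rewrite -(ler_nat R) !natrD.
  have := both_le j jS; have := S_rich jS.
  move: small C0_gt0; move: C0 #|_|%:R #|both F i j|%:R #|star F j|%:R #|both F z j|%:R.
  by move=> c a b d e; lra.
have := dense_link_small_rest k_large n_large F_uniform F_int zj dense_j.
rewrite -/N -/p => rest_j.
have small_j : #|neither F z j|%:R <= 1 / 100 * C0.
  apply: le_trans rest_j _.
  have /andP[p0 p1] := bias_bounds k_large n_large; rewrite -/p in p0 p1.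
  have := bias2_bin k_large n_large; rewrite -/N -/p -/C0 => hC.
  rewrite (_ : 3 * p ^+ 9 * _ = 3 * p ^+ 7 * (p ^+ 2 * 'C(N, k)%:R)); last by ring.
  have p7 : p ^+ 7 <= (21 / 250) ^+ 7.
    by rewrite lerXn2r ?nnegrE ?(ltW p0) //; lra.
  have p70 : 0 <= p ^+ 7 by rewrite exprn_ge0 // ltW.
  apply: (@le_trans _ _ (3 * p ^+ 7 * (51 / 50 * C0))).
    by rewrite ler_wpM2l // mulr_ge0.
  rewrite mulrA ler_wpM2r ?(ltW C0_gt0) //.
  by move: (p ^+ 7) p7 p70 => q; lra.
move=> l lS lz.
apply: (dense_link_small_rest k_large n_large F_uniform F_int); first by rewrite eq_sym.
have := card_star_le i j z l; rewrite -(ler_nat R) natrD4 [neither F j z]neitherC.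
have := both_le l lS; have := S_rich lS; rewrite -/N -/C0.
move: small small_j C0_gt0; move: C0 #|_|%:R #|neither F z j|%:R #|both F i j|%:R.
by move=> c a a' b; move: #|star F l|%:R #|both F z l|%:R => d e; lra.
Qed.

(** For a sparse pair [i, j], the families [only F i j] and [only F j i] are
    cross-intersecting and of measure at least nearly [p]. [influential_rest] is
    applied to the smaller one. *)
Lemma exists_centre : exists z, nearly_star z.
Proof.
have [i [j [iS jS ij sparse]]] := exists_sparse_pair.
have ji : j != i by rewrite eq_sym.
have sparse' l : l \in S -> #|both F j i|%:R <= theta * #|star F l|%:R.
  by rewrite bothC; apply: sparse.
have large (x y : T) : x \in S ->
    #|both F x y|%:R <= theta * #|star F x|%:R -> (1 - theta) * C0 <= #|only F x y|%:R.
  move=> xS h; have e : #|star F x|%:R = #|both F x y|%:R + #|only F x y|%:R :> R.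
    rewrite -natrD -cardsUI; congr _%:R.
    rewrite (_ : both F x y :&: only F x y = set0); last first.
      apply/setP=> A; rewrite !inE.
      by case: (y \in A); rewrite ?andbF.
    rewrite cards0 addn0; apply: eq_card => A; rewrite !inE.
    by case: (A \in F); case: (x \in A); case: (y \in A).
  apply: (@le_trans _ _ ((1 - theta) * #|star F x|%:R)).
    rewrite ler_wpM2l ?(ltW (S_rich xS)) //; move: theta_le; lra.
  by move: h; rewrite e mulrBl mul1r; move: (theta * _) => t; lra.
have p01 : 0 <= p <= 1.
  by have /andP[p0 p1] := bias_bounds k_large n_large; rewrite -/p in p0 p1; lra.
have dens (x y : T) : x != y -> (1 - theta) * C0 <= #|only F x y|%:R ->
    49 / 50 * p <= prob p (up_closure (trace [set x; y] (only F x y))).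
  move=> xy h; have C1 := bin_gt0_layer (R := R) k_large n_large (leq_subr 1 k).
  rewrite -(ler_pM2r C1); apply: le_trans (bias_density k_large n_large h) _.
  rewrite -(card_only_trace F xy).
  apply: (up_closure_density k_large n_large xy (leq_subr 1 k)).
  by move=> A; apply: card_in_only_trace.
have di := dens i j ij (large i j iS (sparse i iS)).
have dj := dens j i ji (large j i jS (sparse' j jS)).
have [le_ij|/ltW le_ji] := lerP
   (prob p (up_closure (trace [set i; j] (only F i j))))
   (prob p (up_closure (trace [set i; j] (only F j i)))).
  have [z zij hz] := influential_rest k_large n_large F_uniform F_int ij di le_ij.
  by exists z; apply: nearly_star_of_small_rest sparse zij hz.
rewrite setUC in le_ji.
have [z zij hz] := influential_rest k_large n_large F_uniform F_int ji dj le_ji.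
by exists z; apply: nearly_star_of_small_rest sparse' zij hz.
Qed.

End Star.

Definition avoiders (T : finType) (V : {set T}) (l : nat) (G : {set {set T}}) :=
  [set Y : {set T} | [&& Y \subset V, #|Y| == l & [exists A in G, [disjoint Y & A]]]].

(** * Small sets disjoint from a member *)

Section Avoiders.
Local Open Scope ring_scope.
Variables (R : archiRealFieldType) (T : finType) (k : nat).
Hypothesis k_large : 10 * (1000 * 1000) <= k%:R :> R.
Hypothesis n_large : (12 * k < #|T|)%N.
Variables (V : {set T}) (G : {set {set T}}).
Let N := (#|T| - 2)%N.
Hypothesis cardV : #|V| = N.
Hypothesis G_layer : forall A, A \in G -> A \subset V /\ #|A| = k.

Let p : R := bias R k #|T|.
Let C0 : R := 'C(N, k - 2)%:R.
Let C2 : R := 'C(N, k)%:R.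
Let D := avoiders V (k - 2) G.
Let C0_gt0 : 0 < C0 := bin_gt0_layer k_large n_large (leq_subr 2 k).
Let C2_gt0 : 0 < C2 := bin_gt0_layer k_large n_large (leqnn k).
Let p_bounds : 0 < p <= 21 / 250 := bias_bounds k_large n_large.

(** A random set [X] of bias [p' = 4 * k / N] is disjoint from some member of [G]
    with the probability [y] that its complement, of bias [1 - p'], contains a
    member. On the one hand [p <= (1 - p') ^+ 4], so the measure of the
    up-closure of [G] at bias [p] is at most [y ^+ 4]. On the other hand [X] has
    at least [k - 2] elements in [V] except with probability [2^-1 ^+ k], so [y]
    is at most the density of [D] plus [2^-1 ^+ k], and the last term is at most
    half of [y]. *)
Lemma avoiders_power : G != set0 ->
  199 / 200 * #|G|%:R <= (2 * (#|D|%:R / C0)) ^+ 4 * C2.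
Proof.
move=> /set0Pn[A0 A0G]; have [A0V A0k] := G_layer A0G.
have [N0 k0] := (N_gt0 k_large n_large, k_gt0 k_large).
have hN := N_lower k_large n_large; rewrite -/N in N0 hN.
have /andP[p0 p1] := p_bounds.
have p01 : 0 <= p <= 1 by lra.
pose p' : R := 4 * k%:R / #|V|%:R.
have p'0 : 0 < p' by rewrite /p' cardV divr_gt0 // mulr_gt0.
have p'1 : p' <= 7 / 20.
  by rewrite /p' cardV ler_pdivrMr //; move: hN k_large; lra.
have p'01 : 0 <= p' <= 1 by lra.
pose y := prob p' (fun X => up_closure G (~: X)).
pose h := #|D|%:R / C0; pose t : R := 2^-1 ^+ k.
have h0 : 0 <= h by rewrite divr_ge0 // ltW.
have t0 : 0 <= t by rewrite exprn_ge0 ?invr_ge0.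
have k1 : (0 < k)%N by rewrite -(ltr0n R).
have kV : (4 * k <= #|V|)%N.
  by rewrite -(ler_nat R) natrM cardV; move: hN k_large; lra.
have pG : prob p (up_closure G) <= y ^+ 4.
  have -> : y = prob (1 - p') (up_closure G) by rewrite /prob expect_setC.
  apply: prob_upset_exp.
  - exact: up_closure_upset.
  - by lra.
  - by lra.
  apply: le_trans p1 _; apply: (@le_trans _ _ ((13 / 20) ^+ 4)); first by lra.
  by rewrite lerXn2r ?nnegrE //; lra.
have y_le : y <= h + t.
  pose U := [set Y : {set T} | Y \subset V & #|Y| == (k - 2)%N] :\: D.
  have UV A : A \in U -> A \subset V /\ #|A| = (k - 2)%N.
    by rewrite !inE => /and3P[_ -> /eqP].
  have cU : #|U|%:R = C0 - #|D|%:R.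
    rewrite /C0 -cardV -cards_draws /U -natrB.
      by rewrite cardsD (setIidPr _) //; apply/subsetP=> Y; rewrite !inE => /and3P[-> ->].
    by apply: subset_leq_card; apply/subsetP=> Y; rewrite !inE => /and3P[-> ->].
  have disj : prob p' (up_closure U) <= 1 - y.
    rewrite /y -probC; apply: le_prob => // X /existsP[Y /andP[YU YX]].
    apply/negP=> /existsP[A /andP[AG AX]].
    move: YU; rewrite !inE => /and3P[/negP + YV Yk]; apply.
    rewrite YV Yk; apply/existsP; exists A; rewrite AG /=.
    by rewrite -setI_eq0 -subset0 -(setICr X) setISS.
  have := prob_up_closure p'01 UV; rewrite cU cardV -/C0 => hU.
  have := chernoff_lower R (leq_subr 2 k) k1 kV; rewrite -/p' -/t.
  move: hU; set w := prob p' _ => hU hw.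
  have : (1 - h) * (1 - t) <= 1 - y; last first.
    have : 0 <= h * t by rewrite mulr_ge0.
    by lra.
  apply: le_trans disj; rewrite -(ler_pM2r C0_gt0); apply: le_trans hU.
  have -> : (1 - h) * (1 - t) * C0 = (C0 - #|D|%:R) * (1 - t).
    by rewrite /h; field; rewrite gt_eqF.
  by rewrite ler_wpM2l // -cU.
have y_ge : 2 * t <= y.
  apply: (@le_trans _ _ (prob p' (fun X => [disjoint X & A0]))); last first.
    apply: le_prob => // X XA; apply/existsP; exists A0.
    by rewrite A0G -disjoints_subset disjoint_sym.
  rewrite prob_disjoint A0k; apply: (@le_trans _ _ ((13 / 20) ^+ k)); last first.
    by rewrite lerXn2r ?nnegrE //; lra.
  have -> : 13 / 20 = 13 / 10 * 2^-1 :> R by field.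
  rewrite exprMn ler_wpM2r //.
  rewrite (_ : 13 / 10 = 1 + 3 / 10); last by field.
  apply: le_trans (bernoulli _ _); last by lra.
  by move: k_large; lra.
have y0 : 0 <= y by apply: prob_ge0.
have yh : y <= 2 * h by lra.
have := prob_up_closure p01 G_layer; rewrite cardV -/C2.
have := size_concentration (V := V) (leqnn k) k_large p01.
rewrite cardV biasN // => /(_ erefl); set w := prob p _ => hw hG.
apply: (@le_trans _ _ (#|G|%:R * w)); first by rewrite mulrC ler_wpM2l.
apply: le_trans hG _; rewrite ler_wpM2r ?(ltW C2_gt0) //.
by apply: le_trans pG _; rewrite lerXn2r ?nnegrE // mulr_ge0.
Qed.

(** [avoiders_power] bounds the density of [G] by the fourth power of twice the
    density [h] of [D], so a sparse [G] has density much less than [p ^+ 2 * h];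
    and [p ^+ 2] is about the ratio between the sizes of the two layers. *)
Lemma small_family_avoiders (delta : R) : 0 < delta <= 1 ->
  #|G|%:R <= (p ^+ 2 * delta) ^+ 2 * C2 -> #|G|%:R <= 3 * delta * #|D|%:R.
Proof.
move=> /andP[d0 d1] small.
have [->|G0] := eqVneq G set0; first by rewrite cards0 !mulr_ge0 // ltW.
have /andP[p0 p1] := p_bounds.
have := avoiders_power G0; set y := 2 * _ => hy.
have y0 : 0 <= y by rewrite mulr_ge0 // divr_ge0 // ltW.
set t := p ^+ 2 * delta in small.
have t0 : 0 <= t by rewrite mulr_ge0 ?sqr_ge0 // ltW.
have t1 : t <= 1 / 100.
  rewrite /t; apply: (@le_trans _ _ ((21 / 250) ^+ 2 * 1)); last by lra.
  by rewrite ler_pM ?sqr_ge0 ?(ltW d0) // lerXn2r ?nnegrE //; lra.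
(* If [y] is at least [t] the hypothesis suffices, otherwise [y ^+ 4] is much
   smaller than [t * y]. *)
suff h : #|G|%:R <= t * y * C2.
  apply: le_trans h _; rewrite /t /y.
  have -> : p ^+ 2 * delta * (2 * (#|D|%:R / C0)) * C2 =
     2 * delta * #|D|%:R / C0 * (p ^+ 2 * C2) by ring.
  have := bias2_bin k_large n_large; rewrite -/N -/p -/C0 -/C2 => hC.
  apply: (@le_trans _ _ (2 * delta * #|D|%:R / C0 * (51 / 50 * C0))).
    by rewrite ler_wpM2l // divr_ge0 ?(ltW C0_gt0) // !mulr_ge0 // ltW.
  have -> : 2 * delta * #|D|%:R / C0 * (51 / 50 * C0) = 51 / 25 * (delta * #|D|%:R).
    by field; rewrite gt_eqF.
  have : 0 <= delta * #|D|%:R by rewrite mulr_ge0 // ltW.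
  have -> : 3 * delta * #|D|%:R = 3 * (delta * #|D|%:R) by ring.
  by move: (delta * _) => u; lra.
have [ty|/ltW yt] := lerP t y.
  apply: le_trans small _; rewrite ler_wpM2r ?(ltW C2_gt0) //.
  by rewrite expr2 ler_wpM2l.
have y4 : y ^+ 4 <= t * y * (1 / 100).
  have y3 : y ^+ 3 <= t * (1 / 100).
    have h := le_trans yt t1.
    apply: (@le_trans _ _ (t * (1 / 100) * (1 / 100))).
      have y2 : y * y <= t * (1 / 100) by apply: ler_pM.
      have -> : y ^+ 3 = (y * y) * y by ring.
      by apply: ler_pM => //; apply: mulr_ge0.
    by move: t0; lra.
  by rewrite exprSr [leRHS]mulrAC ler_wpM2r.
have : y ^+ 4 * C2 <= t * y * (1 / 100) * C2 by rewrite ler_wpM2r ?(ltW C2_gt0).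
have : 0 <= t * y * C2 by rewrite mulr_ge0 ?(ltW C2_gt0) // mulr_ge0.
rewrite (_ : t * y * (1 / 100) * C2 = t * y * C2 / 100); last by ring.
move: hy; move: (y ^+ 4 * C2) (t * y * C2) #|G|%:R => a b c; lra.
Qed.

End Avoiders.

(** * Ruling out k + 2 elements of large degree *)

Section UnionBound.
Variables (T : finType) (k : nat).
Implicit Types (S : {set T}) (Q : {set {set T}}).

(** Each member of [Q] contains a [j]-subset of [S]; the union bound runs over
    these subsets. *)
Lemma card_large_trace_le S Q j : j <= k -> (forall A, A \in Q -> #|A| = k) ->
  (forall A, A \in Q -> j <= #|A :&: S|) ->
  #|Q| <= 2 ^ #|S| * 'C(#|T| - j, k - j).
Proof.
move=> jk Qk Qj.
pose P := [set D : {set T} | D \subset S & #|D| == j].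
have QP A : A \in Q -> 1 <= \sum_(D in P) (D \subset A).
  move=> AQ; rewrite (_ : \sum_(D in P) _ = #|[set D : {set T} | D \subset A :&: S & #|D| == j]|).
    by rewrite cards_draws bin_gt0 Qj.
  rewrite -sum1dep_card big_mkcond [RHS]big_mkcond /=; apply: eq_bigr => D _.
  by rewrite inE subsetI; case: (D \subset A); case: (D \subset S); case: (#|D| == j).
apply: (@leq_trans (\sum_(A in Q) \sum_(D in P) (D \subset A))).
  by rewrite -sum1_card; apply: leq_sum => A; apply: QP.
rewrite exchange_big; apply: (@leq_trans (\sum_(D in P) 'C(#|T| - j, k - j))).
  apply: leq_sum => D; rewrite inE => /andP[_ /eqP Dj].
  rewrite -Dj -card_supersets ?Dj // -sum1dep_card [leqRHS]big_mkcond [leqLHS]big_mkcond /=.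
  apply: leq_sum => A _; case: (boolP (A \in Q)) => // AQ.
  by rewrite (Qk _ AQ) eqxx andbT; case: (D \subset A).
rewrite sum_nat_const leq_mul2r; apply/orP; right.
rewrite -card_powerset; apply: subset_leq_card; apply/subsetP=> D.
by rewrite !inE => /andP[].
Qed.

End UnionBound.

Lemma half_bounds k : 2 * k./2 <= k <= 2 * k./2 + 1.
Proof. by have := odd_double_half k; rewrite -muln2; case: (odd k) => e; lia. Qed.

Lemma half_shift_le k : 100 <= k -> k./2 + 6 <= k.
Proof. by have /andP[h1 h2] := half_bounds k; lia. Qed.

Lemma half_shift_le_pred2 h k : h + 6 <= k -> h + 4 <= k - 2.
Proof. by lia. Qed.

Lemma pow2_half_le s k : s <= k.+2 -> s <= 3 + 2 * k./2.
Proof. by have /andP[h1 h2] := half_bounds k; lia. Qed.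

Lemma subn_half_shift m h : m - (h + 6) = m - 2 - (h + 4).
Proof. by lia. Qed.

Lemma large_difference k s a b : k.+1 <= s -> a < k./2 + 6 -> 100 <= k ->
  a + b = s -> 2 * k <= 5 * b.
Proof.
move=> ks a_lt k100 ab; have := odd_double_half k; rewrite -muln2.
by case: (odd k) => e; lia.
Qed.

Lemma leq_bin_succ n m : m.*2 < n -> 'C(n, m) <= 'C(n, m.+1).
Proof.
move=> mn; rewrite -(leq_pmul2l (ltn0Sn m)) mul_bin_left leq_mul2r.
by apply/orP; right; move: mn; rewrite -muln2; lia.
Qed.

Lemma leq_bin_shift2 m k : 12 * k < m -> 2 <= k -> 'C(m - 2, k - 2) <= 'C(m - 2, k).
Proof.
case: k => [|[|k]] // km _; rewrite !subn2 /= -subn2.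
by apply: leq_trans (leq_bin_succ _) (leq_bin_succ _); rewrite -muln2; lia.
Qed.

Section BinomialDecay.
Local Open Scope ring_scope.
Variable (R : realFieldType).

(** Each step uses [(k - j) / (m - j) <= k / m]. *)
Lemma bin_decay (c : R) m k j : (j <= k)%N -> (k <= m)%N -> k%:R <= c * m%:R -> 0 <= c <= 1 ->
  'C(m - j, k - j)%:R <= c ^+ j * 'C(m, k)%:R :> R.
Proof.
move=> + km kc /andP[c0 c1].
elim: j => [|j IHj] jk; first by rewrite !subn0 expr0 mul1r.
have {IHj} := IHj (ltnW jk); set a : R := 'C(m - j, k - j)%:R => IHj.
rewrite exprS -mulrA; apply: le_trans (ler_wpM2l c0 IHj).
have := mul_bin_diag (m - j) (k - j.+1).
rewrite (_ : (m - j).-1 = (m - j.+1)%N); last by lia.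
rewrite (_ : (k - j.+1).+1 = (k - j)%N); last by lia.
move/(congr1 (fun i => i%:R : R)); rewrite !natrM -/a => e.
have mj : 0 < (m - j)%:R :> R by rewrite ltr0n; lia.
rewrite -(ler_pM2l mj) e mulrCA mulrA; apply: ler_wpM2r; first exact: ler0n.
rewrite !natrB; try lia.
rewrite mulrBr; have : c * j%:R <= j%:R by rewrite -[leRHS]mul1r ler_wpM2r.
lra.
Qed.

(** [11 / 4] exceeds the cube of [7 / 5], so Bernoulli's inequality gives a cubic
    lower bound on [(11 / 4) ^+ K]. *)
Lemma exp_beats_square K : 1000 * 1000 <= K%:R :> R ->
  1600 * (2 * K%:R + 3) ^+ 2 * 4 ^+ K <= 11 ^+ K :> R.
Proof.
move=> K6.
have K0 : 0 < K%:R :> R by apply: lt_le_trans K6; rewrite mulr_gt0.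
have e11 : 4 ^+ K * ((7 / 5) ^+ K) ^+ 3 <= 11 ^+ K :> R.
  by rewrite -exprM mulnC exprM -exprMn lerXn2r ?nnegrE //; lra.
rewrite mulrC; apply: le_trans e11; rewrite ler_wpM2l ?exprn_ge0 //.
have b : K%:R * (2 / 5) <= (7 / 5) ^+ K :> R.
  rewrite (_ : 7 / 5 = 1 + 2 / 5); last by field.
  apply: le_trans (bernoulli _ _); lra.
apply: (@le_trans _ _ ((K%:R * (2 / 5)) ^+ 3)); last first.
  by rewrite lerXn2r ?nnegrE ?exprn_ge0 ?mulr_ge0 ?(ltW K0) //; lra.
have K2 : (2 * K%:R + 3) ^+ 2 <= 9 * K%:R ^+ 2 :> R.
  have -> : 9 * K%:R ^+ 2 = (3 * K%:R) ^+ 2 :> R by ring.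
  by rewrite lerXn2r ?nnegrE //; lra.
apply: (@le_trans _ _ (1600 * (9 * K%:R ^+ 2))); first by rewrite ler_wpM2l.
have -> : (K%:R * (2 / 5)) ^+ 3 = 8 / 125 * K%:R * K%:R ^+ 2 :> R by field.
by rewrite mulrA ler_wpM2r ?sqr_ge0 //; lra.
Qed.

End BinomialDecay.

Section Conclusion.
Local Open Scope ring_scope.
Variables (R : archiRealFieldType) (T : finType) (k : nat) (F : {set {set T}}).
Hypothesis k_large : 10 * (1000 * 1000) <= k%:R :> R.
Hypothesis n_large : (12 * k < #|T|)%N.
Hypothesis F_uniform : forall A, A \in F -> #|A| = k.
Hypothesis F_int : forall A B, A \in F -> B \in F -> A :&: B != set0.
Variables (S : {set T}) (z : T).
Hypothesis cardS : #|S| = k.+2.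

Let N := (#|T| - 2)%N.
Let p : R := bias R k #|T|.
Let C0 : R := 'C(N, k - 2)%:R.
Let C2 : R := 'C(N, k)%:R.

Hypothesis S_rich : forall l, l \in S -> C0 < #|star F l|%:R.
Hypothesis centre : forall l, l \in S -> l != z ->
  #|neither F z l|%:R <= 3 * p ^+ 9 * C2.

Let C0_gt0 : 0 < C0 := bin_gt0_layer k_large n_large (leq_subr 2 k).
Let C2_gt0 : 0 < C2 := bin_gt0_layer k_large n_large (leqnn k).
Let p_bounds : 0 < p <= 21 / 250 := bias_bounds k_large n_large.

Let G := [set A in F | z \notin A].
Let S' := S :\ z.

(** A member through [z] and [l] meets each member avoiding both, so its trace is
    not an avoider. *)
Lemma card_both_avoiders l : l != z ->
  #|both F z l|%:R + #|avoiders (~: [set z; l]) (k - 2) (neither F z l)|%:R <= C0.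
Proof.
rewrite eq_sym => zl; rewrite -natrD /C0 ler_nat /N -(card_compl2 zl) -cards_draws.
rewrite -(card_both_trace F zl) -cardsUI.
rewrite (_ : _ :&: _ = set0) ?cards0 ?addn0.
  apply: subset_leq_card; apply/subsetP=> A; rewrite in_setU => /orP[].
    by case/(card_in_both_trace F_uniform zl) => AV Ak; rewrite inE AV Ak eqxx.
  by rewrite !inE => /and3P[-> ->].
apply/setP=> A; rewrite [RHS]inE; apply/negP; rewrite inE => /andP[/imsetP[B + ->]].
rewrite !inE => /and3P[BF zB lB] /and3P[_ _ /existsP[A' /andP[+ disj]]].
rewrite inE => /and3P[A'F zA' lA'].
have /set0Pn[w] := F_int BF A'F; rewrite inE => /andP[wB wA'].
move/pred0P: disj => /(_ w) /=; rewrite wA' andbT !inE wB andbT => /negbFE.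
by case/orP=> /eqP wE; move: wA'; rewrite wE; apply/negP.
Qed.

(** The degree of [l] exceeds ['C(N, k - 2)], so the members through [l] that
    avoid [z] outnumber the avoiders by [card_both_avoiders]. *)
Lemma card_avoiders_lt l : l \in S' ->
  #|avoiders (~: [set z; l]) (k - 2) (neither F z l)|%:R <= #|G|%:R :> R.
Proof.
rewrite inE => /andP[]; rewrite inE => lz lS.
have := card_both_avoiders lz; have := S_rich lS.
have : #|star F l|%:R <= #|both F z l|%:R + #|G|%:R :> R.
  rewrite -natrD ler_nat; apply: leq_trans (leq_card_setU _ _).
  apply: subset_leq_card; apply/subsetP=> A; rewrite !inE => /andP[-> ->].
  by case: (z \in A).
lra.
Qed.

Lemma neither_small (delta : R) l : 0 < delta <= 1 -> l \in S' ->
  #|neither F z l|%:R <= (p ^+ 2 * delta) ^+ 2 * C2 ->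
  #|neither F z l|%:R <= 3 * delta * #|G|%:R.
Proof.
move=> d01 lS' small; have /andP[d0 _] := d01.
have zl : z != l by move: lS'; rewrite !inE eq_sym => /andP[].
apply: le_trans (small_family_avoiders k_large n_large (card_compl2 zl)
  (fun A => @card_in_neither T k F F_uniform z l A) d01 small) _.
by rewrite ler_wpM2l ?card_avoiders_lt // mulr_ge0 // ltW.
Qed.

Lemma sum_card_setD :
  (\sum_(A in G) #|S' :\: A| = \sum_(l in S') #|neither F z l|)%N.
Proof.
rewrite (eq_bigr (fun A : {set T} => \sum_(l in S') (l \notin A))%N); last first.
  move=> A _; rewrite -sum1_card big_mkcond /= [RHS]big_mkcond.
  by apply: eq_bigr => l _; rewrite inE; case: (l \in A); case: (l \in S').
rewrite exchange_big; apply: eq_bigr => l _.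
rewrite -sum1_card big_mkcond [RHS]big_mkcond; apply: eq_bigr => A _.
by rewrite !inE; case: (A \in F); case: (z \in A); case: (l \in A).
Qed.

(** Double counting of the pairs of a member avoiding [z] and an element of [S']
    outside it. *)
Lemma sum_card_setD_le (delta : R) : 0 < delta <= 1 ->
  (forall l, l \in S' -> #|neither F z l|%:R <= (p ^+ 2 * delta) ^+ 2 * C2) ->
  \sum_(A in G) #|S' :\: A|%:R <= 3 * delta * #|S'|%:R * #|G|%:R.
Proof.
move=> d01 small; rewrite -natr_sum sum_card_setD natr_sum.
apply: le_trans (ler_sum _ (fun l lS' => neither_small d01 lS' (small l lS'))) _.
by rewrite sumr_const -[leLHS]mulr_natl [leRHS]mulrAC mulrC.
Qed.

Let cardS' : (k.+1 <= #|S'| <= k.+2)%N.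
Proof.
have := cardsD1 z S; rewrite cardS -/S'; case: (z \in S); rewrite ?add1n ?add0n.
  by move=> [<-]; rewrite !leqnn leqnSn.
by move=> <-; rewrite leqnn leqnSn.
Qed.

Let L := (k./2 + 6)%N.

(** With [delta = 1 / 100] a member of [G] misses on average at most 3 percent of
    [S'], while missing all but [k./2 + 5] elements means missing at least
    [2 / 5 * k] of them. *)
Lemma most_members_rich : #|G|%:R <= 2 * #|[set A in G | (L <= #|A :&: S'|)%N]|%:R :> R.
Proof.
have /andP[p0 p1] := p_bounds.
have small l : l \in S' -> #|neither F z l|%:R <= (p ^+ 2 * (1 / 100)) ^+ 2 * C2.
  move=> lS'; have := lS'; rewrite !inE => /andP[lz lS].
  apply: le_trans (centre lS lz) _; rewrite ler_wpM2r ?(ltW C2_gt0) //.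
  have -> : 3 * p ^+ 9 = 3 * p ^+ 5 * p ^+ 4 by ring.
  have -> : (p ^+ 2 * (1 / 100)) ^+ 2 = 1 / (100 * 100) * p ^+ 4 by field.
  rewrite ler_wpM2r ?exprn_ge0 ?(ltW p0) //.
  have : p ^+ 5 <= (21 / 250) ^+ 5 by rewrite lerXn2r ?nnegrE ?(ltW p0) //; lra.
  by move: (p ^+ 5) => q; lra.
have := sum_card_setD_le _ small; rewrite (_ : _ < _ <= _ = true); last by lra.
move=> /(_ isT) sum_le.
pose H := [set A in G | (L <= #|A :&: S'|)%N].
have GH : #|G|%:R = #|H|%:R + #|G :\: H|%:R :> R.
  by rewrite -natrD -(cardsID H G) (setIidPr _) //; apply/subsetP=> A; rewrite inE => /andP[].
have k0 := k_gt0 k_large.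
have low : 2 / 5 * k%:R * #|G :\: H|%:R <= \sum_(A in G) #|S' :\: A|%:R :> R.
  have -> : 2 / 5 * k%:R * #|G :\: H|%:R = \sum_(A in G :\: H) (2 / 5 * k%:R) :> R.
    by rewrite sumr_const -[RHS]mulr_natr.
  rewrite [leRHS](big_setID H) /=.
  rewrite (setIidPr _); last by apply/subsetP=> A; rewrite inE => /andP[].
  apply: ler_wpDl; first by apply: sumr_ge0 => A _; apply: ler0n.
  apply: ler_sum => A; rewrite inE => /andP[AH AG]; move: AH; rewrite inE AG /= -ltnNge => AL.
  have hk : (2 * k <= 5 * #|S' :\: A|)%N.
    have := cardsID A S'; rewrite [S' :&: A]setIC.
    have /andP[S'k _] := cardS'.
    exact: large_difference S'k AL (k_ge k_large (isT : 100 <= 1000)%N).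
  have : 2 * k%:R <= 5 * #|S' :\: A|%:R :> R by rewrite -!natrM ler_nat.
  by lra.
have S'k : #|S'|%:R <= 11 / 10 * k%:R :> R.
  apply: (@le_trans _ _ (k.+2)%:R); first by rewrite ler_nat; have /andP[] := cardS'.
  by rewrite -addn2 natrD; move: k_large; lra.
have := le_trans low sum_le.
rewrite (_ : 3 * (1 / 100) * _ * _ = #|S'|%:R * (3 / 100 * #|G|%:R)); last by field.
move=> h; have : #|S'|%:R * (3 / 100 * #|G|%:R) <= 11 / 10 * k%:R * (3 / 100 * #|G|%:R) :> R.
  by rewrite ler_wpM2r // mulr_ge0 ?divr_ge0.
move=> /(le_trans h).
rewrite (_ : 2 / 5 * k%:R * _ = k%:R * (2 / 5 * #|G :\: H|%:R)); last by ring.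
rewrite (_ : 11 / 10 * k%:R * _ = k%:R * (11 / 10 * (3 / 100 * #|G|%:R))); last by ring.
rewrite ler_pM2l //; move: GH; rewrite -/H.
by move: #|G|%:R #|H|%:R #|_ :\: _|%:R (ler0n R #|H|) => a b c b0; lra.
Qed.

(** By the union bound, at most [2 ^ (k + 2)] times ['C(n - L, k - L)] members of
    [G] have [L] elements in [S'], and the latter is about [p ^+ L * 'C(n, k)].
    With [L = k./2 + 6], four powers of [p] remain after
    [(4 * p) ^+ (k./2)] has been made exponentially small. *)
Lemma rest_exponentially_small : #|G|%:R <= (p ^+ 2 * (1 / (10 * k.+2%:R))) ^+ 2 * C2.
Proof.
have /andP[p0 p1] := p_bounds; have k0 := k_gt0 k_large.
pose K := k./2; pose h : R := K%:R.
have kE : (2 * K <= k <= 2 * K + 1)%N := half_bounds k.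
have hk : k%:R <= 2 * h + 1.
  by rewrite /h -natrM natr1 ler_nat -addn1; have /andP[] := kE.
have Kh : 1000 * 1000 <= h by move: k_large; lra.
have Lk : (L <= k)%N := half_shift_le (k_ge k_large (isT : 100 <= 1000)%N).
apply: le_trans most_members_rich _.
have union := @card_large_trace_le T k S' [set A in G | (L <= #|A :&: S'|)%N] L Lk.
have {union} : (#|[set A in G | (L <= #|A :&: S'|)%N]| <= 2 ^ #|S'| * 'C(#|T| - L, k - L))%N.
  by apply: union => A; rewrite !inE => /andP[] // /andP[AF _] _; apply: F_uniform.
rewrite -(ler_nat R) natrM natrX; set g := #|_|%:R => hg.
have S'2 : 2 ^+ #|S'| <= 8 * 4 ^+ K :> R.
  rewrite (_ : 8 * 4 ^+ K = 2 ^+ (3 + 2 * K)); last by rewrite exprD exprM; congr (_ * _ ^+ _); ring.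
  by rewrite ler_weXn2l ?ler1n //; have /andP[_ h1] := cardS'; apply: pow2_half_le h1.
have kN : (k <= N)%N := k_le_N k_large n_large.
have bin_le : 'C(#|T| - L, k - L)%:R <= p ^+ (K + 4) * C2.
  have -> : (#|T| - L = N - (K + 4))%N := subn_half_shift _ _.
  have -> : (k - L = k - 2 - (K + 4))%N := subn_half_shift _ _.
  apply: le_trans (bin_decay (c := p) (m := N) (k := (k - 2)%N) _ _ _ _) _.
  - exact: half_shift_le_pred2 Lk.
  - by apply: leq_trans (leq_subr _ _) kN.
  - rewrite biasN //; apply: (@le_trans _ _ k%:R); first by rewrite ler_nat leq_subr.
    by lra.
  - by lra.
  rewrite ler_wpM2l ?exprn_ge0 ?(ltW p0) // ler_nat.
  exact: leq_bin_shift2 n_large (k_ge k_large (isT : 2 <= 1000)%N).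
have key : 2 * (8 * 4 ^+ K) * p ^+ K <= (1 / (10 * k.+2%:R)) ^+ 2.
  have c0 : 0 < k.+2%:R :> R by rewrite ltr0n.
  have hc : k.+2%:R <= 2 * h + 3 by rewrite -addn2 natrD; lra.
  have inv_sqr (c : R) : 0 < c -> (1 / (10 * c)) ^+ 2 = 1 / (100 * c ^+ 2).
    by move=> c_gt0; field; rewrite gt_eqF.
  rewrite inv_sqr //.
  rewrite ler_pdivlMr ?mulr_gt0 ?exprn_gt0 //.
  apply: (@le_trans _ _ (11 ^+ K * p ^+ K)).
    rewrite (_ : _ * (100 * _) = 1600 * k.+2%:R ^+ 2 * 4 ^+ K * p ^+ K); last by ring.
    rewrite ler_wpM2r ?exprn_ge0 ?(ltW p0) //; apply: le_trans (exp_beats_square Kh).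
    rewrite ler_wpM2r ?exprn_ge0 // ler_wpM2l // lerXn2r ?nnegrE ?(ltW c0) //.
    exact: le_trans (ltW c0) hc.
  have p11 : 0 <= 11 * p by rewrite mulr_ge0 // ltW.
  have p11' : 11 * p <= 1 by lra.
  by rewrite -exprMn exprn_ile1.
apply: (@le_trans _ _ (2 * (8 * 4 ^+ K * (p ^+ (K + 4) * C2)))).
  rewrite ler_wpM2l //; apply: le_trans hg _.
  by rewrite ler_pM ?exprn_ge0 ?ler0n.
rewrite (exprD p K 4) [X in _ <= X * _]exprMn.
have -> : 2 * (8 * 4 ^+ K * (p ^+ K * p ^+ 4 * C2)) = (2 * (8 * 4 ^+ K) * p ^+ K) * (p ^+ 4 * C2) by ring.
have -> : (p ^+ 2) ^+ 2 * (1 / (10 * k.+2%:R)) ^+ 2 * C2 = (1 / (10 * k.+2%:R)) ^+ 2 * (p ^+ 4 * C2) by ring.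
by rewrite ler_wpM2r // mulr_ge0 ?exprn_ge0 ?(ltW p0) ?(ltW C2_gt0).
Qed.

(** With [delta = 1 / (10 * (k + 2))] a member of [G] misses on average less than
    one element of [S'], so some member contains [S'], which has more than [k]
    elements. And [G] is not empty, for a star has all degrees but one at most
    ['C(N, k - 2)]. *)
Lemma no_rich_set : False.
Proof.
have G0 : 0 < #|G|%:R :> R.
  rewrite ltr0n card_gt0; apply/set0Pn.
  have /set0Pn[l] : S' != set0 by rewrite -card_gt0; have /andP[h _] := cardS'; apply: leq_trans h.
  move=> lS'; move: (lS'); rewrite !inE => /andP[lz lS].
  case: (pickP (mem G)) => [A AG|G0]; first by exists A.
  have := card_avoiders_lt lS'; have := card_both_avoiders lz; have := S_rich lS.
  have -> : star F l = both F z l.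
    apply/setP=> A; rewrite !inE; have := G0 A; rewrite !inE.
    by case: (A \in F) => //=; case: (z \in A).
  have := ler0n R #|avoiders (~: [set z; l]) (k - 2) (neither F z l)|.
  lra.
have k0 : 0 < k.+2%:R :> R by rewrite ltr0n.
pose delta : R := 1 / (10 * k.+2%:R).
have d01 : 0 < delta <= 1.
  rewrite divr_gt0 ?mulr_gt0 //= ler_pdivrMr ?mulr_gt0 // mul1r.
  by rewrite -natr1 -natr1; have := ler0n R k; lra.
have small l : l \in S' -> #|neither F z l|%:R <= (p ^+ 2 * delta) ^+ 2 * C2.
  move=> _; apply: le_trans rest_exponentially_small.
  rewrite ler_nat; apply: subset_leq_card; apply/subsetP=> A.
  by rewrite !inE => /and3P[-> ->].
have := sum_card_setD_le d01 small.
have : #|G|%:R <= \sum_(A in G) #|S' :\: A|%:R :> R.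
  rewrite -natr_sum ler_nat -sum1_card; apply: leq_sum => A; rewrite inE => /andP[AF _].
  rewrite card_gt0; apply/negP; rewrite setD_eq0 => /subset_leq_card.
  by rewrite (F_uniform AF) leqNgt; have /andP[-> _] := cardS'.
move=> /le_trans h /h.
apply/negP; rewrite -ltNge -[ltRHS]mul1r ltr_pM2r //.
have : #|S'|%:R <= k.+2%:R :> R by rewrite ler_nat; have /andP[] := cardS'.
rewrite /delta -mulrA mulrC.
have split_inv (c d : R) : 0 < c -> 1 / (10 * c) * d * 3 = 3 / 10 * (d / c).
  by move=> c_gt0; field; rewrite gt_eqF.
rewrite split_inv //.
have : #|S'|%:R / k.+2%:R <= 1 :> R.
  by rewrite ler_pdivrMr // mul1r ler_nat; have /andP[] := cardS'.
by move: (_ / k.+2%:R) => a; lra.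
Qed.

End Conclusion.

(** * The r-th largest degree *)

Lemma dlargest_gt n (F : {set {set 'I_n}}) r c : c < dlargest F r.+1 ->
  exists2 S : {set 'I_n}, #|S| = r.+1 & forall i, i \in S -> c < degree F i.
Proof.
rewrite /dlargest /degree_seq /=; set s := [seq _ | i : _]; set t := sort geq s => ct.
have rt : r < size t by rewrite ltnNge; apply: contraTN ct => rt; rewrite nth_default.
have t_sorted : sorted geq t by apply: sort_sorted => a b; apply: leq_total.
have geq_tr : transitive geq by move=> a b d ba ad; apply: leq_trans ad ba.
have top_gt : all (ltn c) (take r.+1 t).
  apply/(all_nthP 0) => j; rewrite size_take_min leq_min => /andP[jr jt] /=.
  rewrite nth_take //; apply: leq_trans ct _.
  exact: (sorted_leq_nth geq_tr leqnn 0 t_sorted).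
have many : r.+1 <= #|[set i | c < degree F i]|.
  have -> : #|[set i | c < degree F i]| = count (ltn c) t.
    by rewrite count_sort /s count_map -size_filter cardsE cardE enumT.
  rewrite -[t](cat_take_drop r.+1) count_cat; move: top_gt; rewrite all_count => /eqP->.
  by rewrite size_takel // leq_addr.
case/card_geqP: many => e [e_uniq e_size e_sub].
exists [set i in e]; first by rewrite cardsE (card_uniqP e_uniq).
by move=> i; rewrite inE => /e_sub; rewrite inE.
Qed.

Lemma exists_large_nat (R : archiRealFieldType) : exists k0 : nat,
  forall k, k0 <= k -> (10 * (1000 * 1000) <= k%:R :> R)%R.
Proof.
exists (Num.Def.archi_bound (10 * (1000 * 1000) : R)) => k k0k.
apply: le_trans (ltW (archi_boundP _)) _; first by rewrite !mulr_ge0.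
by rewrite ler_nat.
Qed.

Lemma dlargest_le_of_large (R : archiRealFieldType) k n (F : {set {set 'I_n}}) :
  (10 * (1000 * 1000) <= k%:R :> R)%R -> 12 * k < n ->
  F \subset ksets n k -> intersecting F -> dlargest F k.+2 <= 'C(n - 2, k - 2).
Proof.
move=> k_large kn Fk Fint.
have n_large : 12 * k < #|'I_n| by rewrite card_ord.
have F_uniform A : A \in F -> #|A| = k.
  by move=> /(subsetP Fk); rewrite inE => /eqP.
have F_int A B : A \in F -> B \in F -> A :&: B != set0.
  by move=> AF BF; rewrite -card_gt0; apply: Fint.
rewrite leqNgt; apply/negP=> /dlargest_gt[S cardS S_gt].
have S_rich l : l \in S -> ('C(#|'I_n| - 2, k - 2)%:R < #|star F l|%:R :> R)%R.
  by move=> /S_gt; rewrite ltr_nat card_ord.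
have [z centre] := exists_centre k_large n_large F_uniform F_int cardS S_rich.
exact (no_rich_set k_large n_large F_uniform F_int cardS S_rich centre).
Qed.

Theorem theorem1p4 :
  exists k0 : nat, forall k n : nat, k0 <= k -> 12 * k < n ->
    forall F : {set {set 'I_n}}, F \subset ksets n k -> intersecting F ->
      dlargest F k.+2 <= 'C(n - 2, k - 2).
Proof.
have [k0 k0_large] := exists_large_nat rat.
exists k0 => k n k0k kn F Fk Fint.
exact (dlargest_le_of_large (k0_large k k0k) kn Fk Fint).
Qed.
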